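(* For every $i\ge0$: $\nu(Z_{i,0}(d_{i,0}))=0$; $$\nu(Z_{i,0}(d_{i,0}+1))\ \begin{cases}=1,& i\equiv 2\pmod 4,\\ \ge 2,& i\not\equiv 2\pmod 4;\end{cases}$$ and for every $M\ge2$, $\nu(Z_{i,0}(d_{i,0}+M))\ge M+1$.
   Context: Let $E(q)=\prod_{m\ge1}(1-q^m)$. Define $$\gamma(q)=\frac{E(q)^5E(q^2)^5E(q^6)^5}{E(q^3)^{15}},\quad \xi=\xi(q)=\frac{E(q^2)^5E(q^6)}{E(q)E(q^3)^5},\quad \kappa(q)=\frac{\gamma(q^2)^2}{\gamma(q)},$$ and let $U\left(\sum_n a_nq^n\right)=\sum_n a_{2n}q^n$. For $i,j\ge0$, $\zeta_{i,j}=U(\kappa^i\xi^j)$, which equals a polynomial in $\xi$ with integer coefficients; write $\zeta_{i,j}=\sum_m Z_{i,j}(m)\xi^m$. Define $d_{i,j}=5I+J$ if $(i,j)=(2I,2J)$; $5I+J+1$ if $(i,j)=(2I,2J+1)$; $5I+J+3$ if $(i,j)=(2I+1,2J)$ or $(2I+1,2J+1)$. $\nu(n)$ is the $2$-adic valuation of an integer $n$ (the largest $\alpha\ge0$ with $2^\alpha\mid n$), with $\nu(0)=\infty$. *)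

(* Defs.v *)
(* Formal power series over int are represented by their
   coefficient sequences  nat -> int  (coefficient of q^n). *)
From mathcomp Require Import all_boot all_order all_algebra.
Set Implicit Arguments. Unset Strict Implicit. Unset Printing Implicit Defensive.
Import GRing.Theory Num.Theory.
Local Open Scope ring_scope.

Definition ps := nat -> int.

Definition psone : ps := fun n => if n == 0%N then 1 else 0.

Definition psmul (f g : ps) : ps :=
  fun n => \sum_(k < n.+1) f k * g (n - k)%N.

Fixpoint psexp (f : ps) (k : nat) : ps :=
  match k with 0%N => psone | k'.+1 => psmul f (psexp f k') end.

(* first n+1 coefficients of the inverse of a series with constant term 1 *)
Fixpoint psinv_upto (f : ps) (n : nat) : seq int :=
  match n with
  | 0%N => [:: 1]
  | n'.+1 => let s := psinv_upto f n' in
             rcons s (- \sum_(1 <= k < n'.+2) f k * nth 0 s (n'.+1 - k)%N)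
  end.

Definition psinv (f : ps) : ps := fun n => nth 0 (psinv_upto f n) n.

Definition dilate (k : nat) (f : ps) : ps :=
  fun n => if (k %| n)%N then f (n %/ k)%N else 0.

Definition Uop (f : ps) : ps := fun n => f (2 * n)%N.

(* E(q^k) = prod_{m>=1} (1 - q^{km}); the coefficient of q^n only depends
   on the factors with m <= n (for k >= 1). *)
Definition Eq (k : nat) : ps :=
  fun n => (\prod_(1 <= m < n.+1) (1 - 'X^(k * m)) : {poly int})`_n.

Definition gamma : ps :=
  psmul (psexp (Eq 1) 5)
   (psmul (psexp (Eq 2) 5) (psmul (psexp (Eq 6) 5) (psinv (psexp (Eq 3) 15)))).

Definition xi : ps :=
  psmul (psexp (Eq 2) 5) (psmul (Eq 6) (psinv (psmul (Eq 1) (psexp (Eq 3) 5)))).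

Definition kappa : ps := psmul (psexp (dilate 2 gamma) 2) (psinv gamma).

Definition zeta (i j : nat) : ps := Uop (psmul (psexp kappa i) (psexp xi j)).

Definition pseval (p : {poly int}) (x : ps) : ps :=
  fun n => \sum_(m < size p) p`_m * psexp x m n.

Definition d (i j : nat) : nat :=
  if ~~ odd i then
    (if ~~ odd j then 5 * i./2 + j./2 else 5 * i./2 + j./2 + 1)%N
  else (5 * i./2 + j./2 + 3)%N.

(* 2-adic valuation facts: nu_ge z k  <=>  nu(z) >= k  (true for z = 0,
   since nu(0) = oo);  nu_eq z k <=> nu(z) = k. *)
Definition nu_ge (z : int) (k : nat) : bool := ((2 ^ k)%N%:Z %| z)%Z.
Definition nu_eq (z : int) (k : nat) : bool := nu_ge z k && ~~ nu_ge z k.+1.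

(* Main.v *)
Require Import Defs.
From HB Require Import structures.
From mathcomp Require Import all_boot all_order all_algebra.
From mathcomp Require Import boolp.
From mathcomp Require Import zify ring.
Set Implicit Arguments. Unset Strict Implicit. Unset Printing Implicit Defensive.
Import GRing.Theory Num.Theory.
Local Open Scope ring_scope.

(* With a(q) = E(q^2)^3 E(q^3)^2 / (E(q)^2 E(q^6)) and b(q) = E(q^6)^3 / E(q^2) one has the
   2-dissection E(q^3)^3 / E(q) = a(q^2) + q b(q^2).  Multiplying it by its image under
   q -> -q gives q b^2 xi = a^2 (xi - 1), while kappa = g(q^2) (a(q^2) + q b(q^2))^5 with
   g a^5 = xi^5.  Hence U(kappa) = xi^3 (16 xi^2 - 20 xi + 5) and kappa(q) kappa(-q) =
   xi(q^2)^5, so that z_i = U(kappa^i) satisfies the Chebyshev-like recurrence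
   z_{i+2} = 2 z_1 z_{i+1} - xi^5 z_i.  The valuations follow because, up to a power of X,
   z_i is an integer polynomial in 4X, divided by 2 when i is even.

   The 2-dissection is a statement on lattices: comparing coefficients of z^0 in the
   Jacobi triple product in base q and in its three factors in base q^3 gives
     E(q^3)^3 / E(q) = sum over a, b in Z of q^(3(a^2+ab+b^2)+a+2b),
   the points with a even and b odd contribute q times the same series at q^4, and the
   others are in weight-preserving bijection with the points (x, l) of weight
   3x^2 + x + 4l^2 + 2l, whose generating series is a product of two theta functions. *)

(** * Power series as an integral domain *)

(** A coefficient of a product depends only on truncations of the factors, so the ring laws of
    [psmul] are inherited from polynomials. *)
Definition trunc (N : nat) (f : ps) : {poly int} := \poly_(i < N) f i.

Lemma psmul_trunc (N n : nat) (f g : ps) :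
  (n < N)%N -> psmul f g n = (trunc N f * trunc N g)`_n.
Proof.
move=> ltnN; rewrite coefM; apply: eq_bigr => i _.
by rewrite !coef_poly (leq_ltn_trans (leq_ord i)) // (leq_ltn_trans (leq_subr _ _)).
Qed.

Lemma psaddA : associative (fun f g : ps => (fun n => f n + g n) : ps).
Proof. by move=> f g h; apply/funext => n; rewrite addrA. Qed.

Lemma psaddC : commutative (fun f g : ps => (fun n => f n + g n) : ps).
Proof. by move=> f g; apply/funext => n; rewrite addrC. Qed.

Lemma psadd0 : left_id ((fun=> 0) : ps) (fun f g : ps => (fun n => f n + g n) : ps).
Proof. by move=> f; apply/funext => n; rewrite add0r. Qed.

Lemma psaddN : left_inverse ((fun=> 0) : ps) (fun f : ps => (fun n => - f n) : ps)
  (fun f g : ps => (fun n => f n + g n) : ps).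
Proof. by move=> f; apply/funext => n; rewrite addNr. Qed.

Lemma psmulC : commutative psmul.
Proof. by move=> f g; apply/funext => n; rewrite !(psmul_trunc _ _ (ltnSn n)) mulrC. Qed.

Lemma coef_trunc_psmul (N k : nat) (f g : ps) :
  (k < N)%N -> (trunc N (psmul f g))`_k = (trunc N f * trunc N g)`_k.
Proof. by move=> ltkN; rewrite coef_poly ltkN (psmul_trunc _ _ ltkN). Qed.

Lemma psmulA : associative psmul.
Proof.
move=> f g h; apply/funext => n; rewrite !(psmul_trunc _ _ (ltnSn n)).
pose F := trunc n.+1 f; pose G := trunc n.+1 g; pose H := trunc n.+1 h.
transitivity (F * (G * H))`_n; last rewrite mulrA.
  rewrite !coefM; apply: eq_bigr => i _.
  by rewrite coef_trunc_psmul // ltnS leq_subr.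
by rewrite !(coefM _ H); apply: eq_bigr => i _; rewrite coef_trunc_psmul.
Qed.

Lemma psmul1 : left_id psone psmul.
Proof.
move=> f; apply/funext => n; rewrite /psmul big_ord_recl /= mul1r subn0 big1 ?addr0 //.
by move=> i _; rewrite /= mul0r.
Qed.

Lemma psmulDl : left_distributive psmul (fun f g : ps => (fun n => f n + g n) : ps).
Proof.
move=> f g h; apply/funext => n; rewrite /psmul -big_split /=.
by apply: eq_bigr => i _; rewrite mulrDl.
Qed.

HB.instance Definition _ := gen_eqMixin ps.
HB.instance Definition _ := gen_choiceMixin ps.
HB.instance Definition _ := GRing.isZmodule.Build ps psaddA psaddC psadd0 psaddN.

Lemma psone_neq0 : psone != (0 : ps).
Proof. by apply/eqP => /(congr1 (fun f : ps => f 0%N)). Qed.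

HB.instance Definition _ := GRing.Zmodule_isComNzRing.Build ps
  psmulA psmulC psmul1 psmulDl psone_neq0.

(** Units and inverses are taken classically; [psinv_inv] identifies the inverse with the recursion
    [psinv] when the constant term is 1. *)
Definition ps_unit : pred ps := fun f => `[< exists g : ps, g * f = 1 >].

Definition ps_inv (f : ps) : ps :=
  if pselect (exists g : ps, g * f = 1) is left ex then projT1 (cid ex) else f.

Lemma ps_mulVx : {in ps_unit, left_inverse 1 ps_inv *%R}.
Proof. by move=> f /asboolP; rewrite /ps_inv; case: pselect => // ex _; case: cid. Qed.

Lemma ps_unitPl (f g : ps) : g * f = 1 -> ps_unit f.
Proof. by move=> gf; apply/asboolP; exists g. Qed.

Lemma ps_inv_out : {in [predC ps_unit], ps_inv =1 id}.
Proof. by move=> f /asboolP; rewrite /ps_inv; case: pselect. Qed.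

HB.instance Definition _ := GRing.ComNzRing_hasMulInverse.Build ps
  ps_mulVx ps_unitPl ps_inv_out.

Lemma psM (f g : ps) n : (f * g) n = \sum_(k < n.+1) f k * g (n - k)%N.
Proof. by []. Qed.
Lemma psD (f g : ps) n : (f + g) n = f n + g n. Proof. by []. Qed.
Lemma psN (f : ps) n : (- f) n = - f n. Proof. by []. Qed.
Lemma ps0 n : (0 : ps) n = 0. Proof. by []. Qed.
Lemma ps1 n : (1 : ps) n = (n == 0%N)%:R. Proof. by case: n. Qed.
Lemma psM0 (f g : ps) : (f * g) 0%N = f 0%N * g 0%N.
Proof. by rewrite psM big_ord_recl big_ord0 addr0. Qed.

Lemma ps_valuation (f : ps) : f != 0 ->
  exists2 n, f n != 0 & forall k, (k < n)%N -> f k = 0.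
Proof.
move=> f0; have ex : exists n, f n != 0.
  apply: contrapT => nex; move/eqP: f0; apply; apply/funext => n.
  by apply/eqP; apply: contrapT => fn; apply: nex; exists n; apply/negP.
exists (ex_minn ex); case: ex_minnP => // n fn nmin k ltkn.
by apply/eqP; apply: contraTT ltkn => fk; rewrite -leqNgt nmin.
Qed.

Lemma ps_integral : GRing.integral_domain_axiom ps.
Proof.
move=> f g fg0; apply: contraT; rewrite negb_or => /andP[].
move=> /ps_valuation[n fn nmin] /ps_valuation[m gm mmin].
have := congr1 (fun h : ps => h (n + m)%N) fg0; rewrite psM ps0.
have ltn : (n < (n + m).+1)%N by rewrite ltnS leq_addr.
(* The lowest nonzero coefficients [f n] and [g m] give the only nonzero term at index n + m. *)
rewrite (bigD1 (Ordinal ltn)) //= addKn big1 ?addr0 => [|i].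
  by move/eqP; rewrite mulf_eq0 (negPf fn) (negPf gm).
rewrite -val_eqE /= neq_ltn => /orP[lin|lni]; first by rewrite nmin ?mul0r.
by rewrite mmin ?mulr0 //; have := ltn_ord i; move: lni; rewrite /=; lia.
Qed.

HB.instance Definition _ := GRing.ComUnitRing_isIntegral.Build ps ps_integral.

Lemma psexpE (f : ps) k : psexp f k = f ^+ k.
Proof. by elim: k => // k IHk; rewrite exprS -IHk. Qed.

Lemma size_psinv_upto f n : size (psinv_upto f n) = n.+1.
Proof. by elim: n => //= n IHn; rewrite size_rcons IHn. Qed.

Lemma nth_psinv_upto f n k : (k <= n)%N -> nth 0 (psinv_upto f n) k = psinv f k.
Proof.
elim: n => [|n IHn]; first by rewrite leqn0 => /eqP->.
rewrite leq_eqVlt => /orP[/eqP-> //|ltkn] /=.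
by rewrite nth_rcons size_psinv_upto ltkn IHn.
Qed.

Lemma psinvE (f : ps) : f 0%N = 1 -> f * psinv f = 1.
Proof.
move=> f0; apply/funext => -[|n]; first by rewrite psM0 f0.
rewrite psM big_ord_recl f0 mul1r subn0 {1}/psinv /=.
rewrite nth_rcons size_psinv_upto ltnn eqxx big_add1 big_mkord.
rewrite addrC; apply/eqP; rewrite subr_eq0; apply/eqP/eq_bigr => i _.
by rewrite /= nth_psinv_upto // subSS leq_subr.
Qed.

Lemma ps_unitP (f : ps) : f 0%N = 1 -> f \is a GRing.unit.
Proof. by move=> f0; apply/unitrPr; exists (psinv f); exact: psinvE. Qed.

Lemma psinv_inv (f : ps) : f 0%N = 1 -> psinv f = f^-1.
Proof.
move=> f0; apply: (mulrI (ps_unitP f0)); rewrite psinvE // divrr //.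
exact: ps_unitP.
Qed.

(** * Congruences, dilation and sign change *)

(** Congruence modulo the ideal (u). Infinite products and theta series are compared modulo every
    q^N, where finite truncations suffice; [eqm_ps_ext] then concludes. *)
Definition eqm (R : comNzRingType) (u x y : R) : Prop := exists h, x = y + u * h.

Section Congruence.
Variables (R : comNzRingType) (u : R).
Implicit Types x y z t : R.

Lemma eqm_refl x : eqm u x x.
Proof. by exists 0; rewrite mulr0 addr0. Qed.

Lemma eqm_sym x y : eqm u x y -> eqm u y x.
Proof. by case=> h ->; exists (- h); ring. Qed.

Lemma eqm_trans y x z : eqm u x y -> eqm u y z -> eqm u x z.
Proof. by case=> h -> [k ->]; exists (h + k); ring. Qed.

Lemma eqmD x y z t : eqm u x y -> eqm u z t -> eqm u (x + z) (y + t).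
Proof. by case=> h -> [k ->]; exists (h + k); ring. Qed.

Lemma eqmM x y z t : eqm u x y -> eqm u z t -> eqm u (x * z) (y * t).
Proof. by case=> h -> [k ->]; exists (h * t + k * y + u * h * k); ring. Qed.

Lemma eqmMl x y z : eqm u y z -> eqm u (x * y) (x * z).
Proof. exact: eqmM (eqm_refl x). Qed.

Lemma eqmMr x y z : eqm u y z -> eqm u (y * x) (z * x).
Proof. by move=> e; exact: eqmM e (eqm_refl x). Qed.

Lemma eqm_sum (I : eqType) (r : seq I) (P : pred I) (F G : I -> R) :
  (forall i, i \in r -> P i -> eqm u (F i) (G i)) ->
  eqm u (\sum_(i <- r | P i) F i) (\sum_(i <- r | P i) G i).
Proof.
move=> e; rewrite !(big_seq_cond P).
elim/big_rec2: _ => [|i x y /andP[ri Pi] exy]; first exact: eqm_refl.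
by apply: eqmD => //; exact: e.
Qed.

End Congruence.

Lemma eqm_dvd (R : comNzRingType) (v w x y : R) : eqm (v * w) x y -> eqm v x y.
Proof. by case=> h ->; exists (w * h); rewrite mulrA. Qed.

Lemma eqm_le (R : comNzRingType) (v x y : R) m n :
  (m <= n)%N -> eqm (v ^+ n) x y -> eqm (v ^+ m) x y.
Proof. by move=> /subnKC<-; rewrite exprD; exact: eqm_dvd. Qed.

Lemma eqm_morph (R S : comNzRingType) (f : {rmorphism R -> S}) (v x y : R) :
  eqm v x y -> eqm (f v) (f x) (f y).
Proof. by case=> h ->; exists (f h); rewrite rmorphD rmorphM. Qed.

Lemma eqm_pexp (R : comNzRingType) (v : R) m n : (m <= n)%N -> eqm (v ^+ m) (v ^+ n) 0.
Proof. by move=> /subnKC<-; exists (v ^+ (n - m)); rewrite add0r exprD. Qed.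

Definition psX : ps := fun n => (n == 1%N)%:R.
Local Notation q := psX.

Lemma psXnM k (f : ps) n : (q ^+ k * f) n = if (n < k)%N then 0 else f (n - k)%N.
Proof.
elim: k f n => [|k IHk] f n; first by rewrite mul1r subn0.
rewrite exprSr -mulrA IHk psM; case: ltngtP => // [ltnk|ltkn|<-].
- by rewrite ltnS ltnW.
- rewrite ltnS leqNgt ltkn /= -(subnSK ltkn) !big_ord_recl big1 => [|i _].
    by rewrite /q /= mul0r add0r mul1r addr0 subn1.
  by rewrite /q /= mul0r.
- by rewrite ltnS leqnn subnn big_ord_recl big_ord0 /q mul0r addr0.
Qed.

Lemma psXn k n : (q ^+ k) n = (n == k)%:R.
Proof.
rewrite -[q ^+ k]mulr1 psXnM ps1 subn_eq0; case: (ltngtP n k) => //.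
Qed.

Lemma psX_neq0 : q != 0.
Proof. by apply/eqP => /(congr1 (fun f : ps => f 1%N)). Qed.

Lemma eqm_psP N (f g : ps) :
  eqm (q ^+ N) f g <-> (forall n, (n < N)%N -> f n = g n).
Proof.
split=> [[h ->] n ltnN|e]; first by rewrite psD psXnM ltnN addr0.
exists ((fun n => f (n + N)%N - g (n + N)%N) : ps); apply/funext => n.
rewrite psD psXnM; case: ltnP => [/e->|leNn]; first by rewrite addr0.
by rewrite subnK // addrC subrK.
Qed.

Lemma eqm_ps_ext (f g : ps) : (forall N, eqm (q ^+ N) f g) -> f = g.
Proof.
by move=> e; apply/funext => n; have /eqm_psP := e n.+1; apply.
Qed.

Lemma sum_dilate k (f F : ps) m :
  \sum_(i < (k.+1 * m).+1) dilate k.+1 f i * F i =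
  \sum_(j < m.+1) f j * F (k.+1 * j)%N.
Proof.
rewrite -!(big_mkord xpredT (fun j => dilate k.+1 f j * F j)).
rewrite -!(big_mkord xpredT (fun j => f j * F (k.+1 * j)%N)).
elim: m => [|m IHm]; first by rewrite muln0 !big_nat1 /dilate dvdn0 div0n muln0.
rewrite (big_cat_nat (n := (k.+1 * m).+1)) //=; last by rewrite ltnS leq_mul2l leqnSn orbT.
rewrite IHm [RHS]big_nat_recr //=; congr (_ + _).
rewrite mulnS addnC addnS [LHS]big_nat_recr /=; last by rewrite ltnS leq_addr.
rewrite big1_seq ?add0r => [|i].
  by rewrite /dilate -addnS -mulnSr dvdn_mulr // mulKn.
rewrite mem_index_iota /= => /andP[lti gti].
suff /negPf ndv : ~~ (k.+1 %| i)%N by rewrite /dilate ndv mul0r.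
apply/negP => /dvdnP[j ij]; move: lti gti; rewrite ij.
by rewrite mulnC -addnS -mulSnr !ltn_pmul2r // => mj; rewrite ltnS leqNgt mj.
Qed.

Lemma dilate_zmod_morphism k : zmod_morphism (dilate k).
Proof.
move=> f g; apply/funext => n; rewrite /dilate !psD !psN.
by case: ifP => // _; rewrite subr0.
Qed.

Lemma dilate_monoid_morphism k : monoid_morphism (dilate k.+1).
Proof.
split=> [|f g]; apply/funext => n.
  rewrite /dilate !ps1; case: n => [|n] //=.
  by case: ifP => // dv; rewrite gtn_eqF // divn_gt0 // dvdn_leq.
rewrite [LHS]/dilate; case: ifP => [/dvdnP[m ->]|ndv]; rewrite psM; last first.
  rewrite big1 // => i _; rewrite /dilate; case: ifP => [dvi|]; rewrite ?mul0r //.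
  by rewrite dvdn_subl ?(leq_ord i) // ndv mulr0.
rewrite mulnK // [(m * _)%N]mulnC.
rewrite [RHS](sum_dilate _ f (fun i => dilate k.+1 g (k.+1 * m - i)%N)).
by apply: eq_bigr => j _; rewrite -mulnBr /dilate dvdn_mulr // mulKn.
Qed.

HB.instance Definition _ k := GRing.isZmodMorphism.Build ps ps (dilate k.+1)
  (dilate_zmod_morphism k.+1).
HB.instance Definition _ k := GRing.isMonoidMorphism.Build ps ps (dilate k.+1)
  (dilate_monoid_morphism k).

Lemma dilateX k : dilate k.+1 q = q ^+ k.+1.
Proof.
apply/funext => n; rewrite psXn /dilate /q; case: ifP => [/dvdnP[m ->]|ndv].
  by rewrite mulnK // -{2}[k.+1]mul1n eqn_pmul2r.
by case: eqP => // nk; rewrite nk dvdnn in ndv.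
Qed.

(** U is linear over the series in q^2. This turns a quadratic equation of [kappa] over that subring
    into a recurrence for [zeta]. *)
Lemma Uop_dilateM (f g : ps) : Uop (dilate 2 f * g) = f * Uop g.
Proof.
apply/funext => n; rewrite /Uop psM [LHS](sum_dilate _ f (fun i => g (2 * n - i)%N)) psM.
by apply: eq_bigr => j _; rewrite mulnBr.
Qed.

Lemma Uop1 : Uop 1 = 1.
Proof. by apply/funext => -[|n]. Qed.

Lemma Uop_dilate (f : ps) : Uop (dilate 2 f) = f.
Proof. by rewrite -[dilate 2 f]mulr1 Uop_dilateM Uop1 mulr1. Qed.

Lemma UopD (f g : ps) : Uop (f + g) = Uop f + Uop g.
Proof. by []. Qed.

Lemma UopXdilate (f : ps) : Uop (q * dilate 2 f) = 0.
Proof.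
rewrite mulrC Uop_dilateM (_ : Uop q = 0) ?mulr0 //.
by apply/funext => n; rewrite /Uop /q ps0; case: eqP => //; lia.
Qed.

Lemma dilate2_inj : injective (dilate 2).
Proof. exact: can_inj Uop_dilate. Qed.

(** The substitution q -> -q. *)
Definition flip (f : ps) : ps := fun n => (-1) ^+ n * f n.

Lemma flip_zmod_morphism : zmod_morphism flip.
Proof. by move=> f g; apply/funext => n; rewrite /flip !psD !psN mulrBr. Qed.

Lemma flip_monoid_morphism : monoid_morphism flip.
Proof.
split=> [|f g]; apply/funext => n; first last.
  rewrite /flip !psM mulr_sumr; apply: eq_bigr => i _.
  by rewrite -{1}(subnKC (leq_ord i)) exprD mulrACA.
by rewrite /flip ps1; case: n => [|n]; rewrite ?mulr0 ?mulr1.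
Qed.

HB.instance Definition _ := GRing.isZmodMorphism.Build ps ps flip flip_zmod_morphism.
HB.instance Definition _ := GRing.isMonoidMorphism.Build ps ps flip flip_monoid_morphism.

Lemma flip_dilate (f : ps) : flip (dilate 2 f) = dilate 2 f.
Proof.
apply/funext => n; rewrite /flip /dilate; case: ifP => [|_]; last exact: mulr0.
by rewrite dvdn2 -signr_odd => /negPf->; rewrite mul1r.
Qed.

Lemma flipX : flip q = - q.
Proof.
by apply/funext => n; rewrite /flip psN /q; case: eqP => [->|_]; rewrite ?mulr0 ?oppr0 // mulr1.
Qed.

Lemma flipXn k : flip (q ^+ k) = (-1) ^+ k * q ^+ k.
Proof. by rewrite rmorphXn /= flipX; exact: exprNn. Qed.

(** * Polynomials as series and the partial products of E(q^k) *)

Definition ps_of_poly (p : {poly int}) : ps := fun n => p`_n.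

Lemma ps_of_poly_zmod_morphism : zmod_morphism ps_of_poly.
Proof. by move=> f g; apply/funext => n; rewrite /ps_of_poly coefB. Qed.

Lemma ps_of_poly_monoid_morphism : monoid_morphism ps_of_poly.
Proof.
by split=> [|f g]; apply/funext => n; rewrite /ps_of_poly ?coef1 ?ps1 // coefM.
Qed.

HB.instance Definition _ := GRing.isZmodMorphism.Build {poly int} ps ps_of_poly
  ps_of_poly_zmod_morphism.
HB.instance Definition _ := GRing.isMonoidMorphism.Build {poly int} ps ps_of_poly
  ps_of_poly_monoid_morphism.

Lemma ps_of_polyX : ps_of_poly 'X = q.
Proof. by apply/funext => n; rewrite /ps_of_poly coefX. Qed.

Definition qpoch (k N : nat) : ps := \prod_(i < N) (1 - q ^+ (k * i.+1)).

Lemma qpochS k N : qpoch k N.+1 = qpoch k N * (1 - q ^+ (k * N.+1)).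
Proof. by rewrite /qpoch big_ord_recr. Qed.

Lemma Eq_qpoch (k n : nat) : Eq k n = qpoch k n n.
Proof.
rewrite /Eq -[LHS]/(ps_of_poly _ n) rmorph_prod big_add1 big_mkord /qpoch.
congr (_ n); apply: eq_bigr => i _.
by rewrite rmorphB rmorph1 rmorphXn /= ps_of_polyX.
Qed.

(** A further factor 1 - q^(k m) with m > N changes only coefficients of index at least k m > N. *)
Lemma eqm_Eq k N : (0 < k)%N -> eqm (q ^+ N.+1) (Eq k) (qpoch k N).
Proof.
move=> k0; apply/eqm_psP => n; rewrite ltnS Eq_qpoch => /subnKC<-.
elim: (N - n)%N => [|m ->]; first by rewrite addn0.
rewrite addnS qpochS mulrBr mulr1 psD psN [_ * q ^+ _]mulrC psXnM ifT ?subr0 //.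
by apply: leq_trans (leq_pmull _ k0); rewrite ltnS leq_addr.
Qed.

Lemma Eq_0 k : Eq k 0%N = 1.
Proof. by rewrite /Eq big_geq // coef1. Qed.

Lemma Eq_unit k : Eq k \is a GRing.unit.
Proof. by apply: ps_unitP; exact: Eq_0. Qed.

Lemma Eq_neq0 k : Eq k != 0.
Proof. by apply/eqP => /(congr1 (fun f : ps => f 0%N)); rewrite Eq_0. Qed.

Lemma dilate_Eq j k : (0 < k)%N -> dilate j.+1 (Eq k) = Eq (j.+1 * k).
Proof.
move=> k0; apply: eqm_ps_ext => N.
have := eqm_morph (dilate j.+1) (eqm_Eq N k0); rewrite rmorphXn /= dilateX -exprM.
move/(eqm_le (m := N)) => e; apply: eqm_trans (e _) _; first by rewrite mulSn; lia.
apply/eqm_sym/(eqm_le (leqnSn _)); rewrite [X in eqm _ _ X](_ : _ = qpoch (j.+1 * k) N).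
  by apply: eqm_Eq; rewrite muln_gt0.
rewrite rmorph_prod; apply: eq_bigr => i _.
by rewrite rmorphB rmorph1 rmorphXn /= dilateX -exprM mulnA.
Qed.

(** * The finite Jacobi triple product *)

Section GaussianBinomial.
Variables (R : comNzRingType) (Q : R).

Fixpoint qbin (n j : nat) : R :=
  match n, j with
  | _, 0%N => 1
  | 0%N, _.+1 => 0
  | n'.+1, j'.+1 => qbin n' j' + Q ^+ j'.+1 * qbin n' j'.+1
  end.

Lemma qbin0 n : qbin n 0 = 1. Proof. by case: n. Qed.

Lemma qbinS n j : qbin n.+1 j.+1 = qbin n j + Q ^+ j.+1 * qbin n j.+1.
Proof. by []. Qed.

Lemma qbin_small n j : (n < j)%N -> qbin n j = 0.
Proof.
elim: n j => [|n IHn] [|j] //; rewrite ltnS => ltnj.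
by rewrite qbinS !IHn ?mulr0 ?addr0 // ltnW.
Qed.

Lemma qbinS_alt n j :
  (j <= n)%N -> qbin n.+1 j.+1 = Q ^+ (n - j) * qbin n j + qbin n j.+1.
Proof.
elim: n j => [|n IHn] j lejn.
  by move: lejn; rewrite leqn0 => /eqP->; rewrite qbinS subnn mulr0 !addr0 mul1r.
rewrite qbinS; case: j lejn => [|j] lejn.
  by rewrite !qbin0 mulr1 [in RHS]qbinS qbin0 IHn // qbin0 subn0 mulr1 expr1 exprS; ring.
rewrite {1}IHn // [qbin n.+1 j.+2 in RHS]qbinS [qbin n.+1 j.+1 in RHS]qbinS subSS.
have [ltjn|lenj] := ltnP j n; last first.
  have -> : j = n by apply/eqP; rewrite eqn_leq -ltnS lejn lenj.
  by rewrite qbinS (@qbin_small n n.+2) // !(@qbin_small n n.+1) // subnn; ring.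
rewrite IHn // -(subnSK ltjn).
have -> : Q ^+ j.+2 = Q ^+ j.+1 * Q by rewrite exprSr.
by rewrite [Q ^+ (n - j.+1).+1]exprS; ring.
Qed.

Definition qfact n := \prod_(i < n) (1 - Q ^+ i.+1).

Lemma qfactS n : qfact n.+1 = qfact n * (1 - Q ^+ n.+1).
Proof. by rewrite /qfact big_ord_recr. Qed.

(** The factorial formula, free of division since the ring is arbitrary; it yields the limit of the
    Gaussian binomials in [qbin_mod]. *)
Lemma qbin_fact n j : (j <= n)%N -> qbin n j * (qfact j * qfact (n - j)) = qfact n.
Proof.
elim: n j => [|n IHn] [|j] lejn //; rewrite ?qbin0 ?subn0.
- by rewrite /qfact big_ord0 !mul1r.
- by rewrite [qfact 0]/qfact big_ord0 !mul1r.
rewrite qbinS subSS; have [ltjn|lenj] := ltnP j n; last first.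
  have ejn : j = n by apply/eqP; rewrite eqn_leq -ltnS lejn lenj.
  rewrite ejn (@qbin_small n n.+1) // mulr0 addr0 subnn [qfact n.+1]qfactS.
  by rewrite -[in RHS](IHn n) // subnn; ring.
rewrite mulrDl.
have {1}-> : qfact j.+1 = qfact j * (1 - Q ^+ j.+1) by rewrite qfactS.
have {2}-> : qfact (n - j) = qfact (n - j.+1) * (1 - Q ^+ (n - j)).
  by rewrite -(subnSK ltjn) qfactS.
transitivity ((1 - Q ^+ j.+1) * (qbin n j * (qfact j * qfact (n - j)))
  + (Q ^+ j.+1 * (1 - Q ^+ (n - j))) * (qbin n j.+1 * (qfact j.+1 * qfact (n - j.+1)))).
  by ring.
rewrite !IHn // mulrBr mulr1 -exprD qfactS.
by rewrite addSn subnKC 1?ltnW //; ring.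
Qed.

End GaussianBinomial.

(** The triangular number k(k+1)/2; as k(k+1) is nonnegative for every integer k, the absolute value
    loses nothing. *)
Definition tri (k : int) : nat := (absz (k * (k + 1)%R))./2.

Lemma triE (k : int) : (tri k)%:Z * 2 = k * (k + 1).
Proof.
have ge0 : 0 <= k * (k + 1) by nia.
have ev : ~~ odd (absz (k * (k + 1))).
  rewrite abszM oddM; case: k {ge0} => n.
    by rewrite (_ : absz (n%:Z + 1) = n.+1) /= ?andbN //; lia.
  by rewrite (_ : absz (Negz n + 1) = n) /= ?andNb //; lia.
by rewrite /tri; move: (k * (k + 1)) ge0 ev => m; lia.
Qed.

Lemma tri_le (k : int) : (absz k <= (tri k).+1)%N.
Proof. by have := triE k; nia. Qed.

Lemma tri_le1 (k : int) : (absz k <= (tri (k - 1)).+1)%N.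
Proof. by have := triE (k - 1); nia. Qed.

Lemma triB1 (k : int) : (tri k)%:Z = (tri (k - 1))%:Z + k.
Proof. by have := triE k; have := triE (k - 1); nia. Qed.

(* Ramanujan's f(c, d), with base Q = c d and an extra variable z: in this form the
   exponents of c and d are nonnegative on both sides, so no inverse is needed. *)
Definition jprod (R : comNzRingType) (M N : nat) (c d z : R) : R :=
  \prod_(i < M) (1 + z * (c ^+ i.+1 * d ^+ i)) *
  \prod_(i < N) (z + c ^+ i * d ^+ i.+1).

(** The general term c^(k(k+1)/2) d^(k(k-1)/2) of f(c, d). *)
Definition jweight (R : comNzRingType) (c d : R) (k : int) : R :=
  c ^+ tri k * d ^+ tri (k - 1).

(** Multiplication by a factor linear in z, coefficient by coefficient: the step of both inductions
    in [finite_jacobi]. *)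
Lemma sum_mul_linear (R : comNzRingType) (n : nat) (F G : nat -> R) (u v z : R) :
  F n.+1 = 0 -> G 0%N = u * F 0%N ->
  (forall j, (j <= n)%N -> G j.+1 = v * F j + u * F j.+1) ->
  (\sum_(j < n.+1) F j * z ^+ j) * (u + v * z) = \sum_(j < n.+2) G j * z ^+ j.
Proof.
move=> Fn G0 GS; rewrite [RHS]big_ord_recl /= G0.
rewrite [X in _ = _ + X](_ : _ = v * z * (\sum_(j < n.+1) F j * z ^+ j)
    + u * (\sum_(j < n.+1) F j.+1 * z ^+ j.+1)); last first.
  rewrite !mulr_sumr -big_split /=; apply: eq_bigr => j _.
  by rewrite /bump leq0n add1n GS ?(leq_ord j) // exprS; ring.
rewrite addrCA -[u * _ * _]mulrA -mulrDr.
have -> : F 0%N * z ^+ 0 + \sum_(j < n.+1) F j.+1 * z ^+ j.+1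
        = \sum_(j < n.+1) F j * z ^+ j.
  transitivity (\sum_(j < n.+2) F j * z ^+ j); first by rewrite [RHS]big_ord_recl.
  by rewrite big_ord_recr /= Fn mul0r addr0.
by ring.
Qed.

(** Each new factor is linear in z and is absorbed by a q-Pascal rule: [qbinS] for z + c^N d^(N+1),
    which also shifts the index k, and [qbinS_alt] for 1 + z c^(M+1) d^M. The exponents agree
    because tri k - tri (k - 1) = k. *)
Lemma finite_jacobi (R : comNzRingType) (M N : nat) (c d z : R) :
  jprod M N c d z = \sum_(j < (M + N).+1)
    qbin (c * d) (M + N) j * jweight c d (j%:Z - N%:Z) * z ^+ j.
Proof.
elim: M => [|M IHM]; [elim: N => [|N IHN]|].
- rewrite /jprod !big_ord0 big_ord_recl big_ord0 addr0 qbin0 /jweight.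
  by rewrite -[tri (_ - _ - _)]/0%N -[tri _]/0%N !mulr1.
- rewrite {1}/jprod [in X in _ * X]big_ord_recr /= mulrA -/(jprod 0 N c d z) IHN.
  rewrite !add0n [z + _]addrC -[z in _ * (_ + z)]mul1r.
  apply: (sum_mul_linear (F := fun j => qbin (c * d) N j * jweight c d (j%:Z - N%:Z))
    (G := fun j => qbin (c * d) N.+1 j * jweight c d (j%:Z - N.+1%:Z))) => [||j lejN].
  + by rewrite qbin_small // mul0r.
  + rewrite !qbin0 !mul1r /jweight mulrACA -!exprD.
    congr (_ ^+ _ * _ ^+ _).
    * have := triB1 (0%:Z - N%:Z).
      by rewrite (_ : 0%:Z - N%:Z - 1 = 0%:Z - N.+1%:Z); lia.
    * have := triB1 (0%:Z - N%:Z - 1).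
      by rewrite (_ : 0%:Z - N%:Z - 1 = 0%:Z - N.+1%:Z); lia.
  + rewrite mul1r qbinS mulrDl (_ : j.+1%:Z - N.+1%:Z = j%:Z - N%:Z); last by lia.
    congr (_ + _); rewrite -mulrA mulrCA [RHS]mulrCA; congr (_ * _).
    rewrite /jweight exprMn mulrACA -!exprD mulrACA -!exprD.
    have := triB1 (j.+1%:Z - N%:Z); have := triB1 (j%:Z - N%:Z).
    rewrite (_ : j.+1%:Z - N%:Z - 1 = j%:Z - N%:Z); last by lia.
    by move=> e1 e2; congr (_ ^+ _ * _ ^+ _); lia.
- rewrite /jprod [in X in X * _]big_ord_recr /= mulrAC -/(jprod M N c d z) IHM.
  rewrite [z * _]mulrC.
  apply: (sum_mul_linear (F := fun j => qbin (c * d) (M + N) j * jweight c d (j%:Z - N%:Z))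
    (G := fun j => qbin (c * d) (M + N).+1 j * jweight c d (j%:Z - N%:Z))) => [||j lejn].
  + by rewrite qbin_small // mul0r.
  + by rewrite !qbin0 !mul1r.
  + rewrite qbinS_alt // mulrDl mul1r; congr (_ + _).
    rewrite -mulrA mulrCA [RHS]mulrCA; congr (_ * _).
    rewrite /jweight exprMn mulrACA -!exprD mulrACA -!exprD.
    have := triB1 (j.+1%:Z - N%:Z); have := triB1 (j%:Z - N%:Z).
    rewrite (_ : j.+1%:Z - N%:Z - 1 = j%:Z - N%:Z); last by lia.
    by move=> e1 e2; congr (_ ^+ _ * _ ^+ _); lia.
Qed.

(** * Theta series modulo q^n *)

Lemma qbin_morph (R S : comNzRingType) (f : {rmorphism R -> S}) (Q : R) n j :
  f (qbin Q n j) = qbin (f Q) n j.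
Proof.
elim: n j => [|n IHn] [|j]; rewrite ?qbin0 ?rmorph1 //=; first exact: rmorph0.
by rewrite rmorphD rmorphM rmorphXn /= !IHn.
Qed.

Lemma jprod_morph (R S : comNzRingType) (f : {rmorphism R -> S}) M N (c d z : R) :
  f (jprod M N c d z) = jprod M N (f c) (f d) (f z).
Proof.
rewrite /jprod rmorphM !rmorph_prod; congr (_ * _); apply: eq_bigr => i _;
by rewrite rmorphD ?rmorph1 !rmorphM !rmorphXn.
Qed.

Lemma qfact_qpoch k N : qfact (q ^+ k) N = qpoch k N.
Proof. by apply: eq_bigr => i _; rewrite exprM. Qed.

Lemma eqm_Eq_le n k N : (0 < k)%N -> (n <= N)%N -> eqm (q ^+ n) (Eq k) (qpoch k N).
Proof. by move=> k0 lenN; apply: eqm_le (eqm_Eq N k0); rewrite leqW. Qed.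

(** When j and m - j are both large, the three q-factorials in [qbin_fact] are all congruent to
    E(q^r). *)
Lemma qbin_mod n r m j : (0 < r)%N -> (n <= j)%N -> (n <= m - j)%N ->
  eqm (q ^+ n) (Eq r * qbin (q ^+ r) m j) 1.
Proof.
move=> r0 lenj lenmj.
have [lejm|] := leqP j m; last first.
  (* Modulo q^0 = 1 any two series are congruent. *)
  move=> ltmj; have -> : n = 0%N by lia.
  by exists (Eq r * qbin (q ^+ r) m j - 1); rewrite mul1r addrC subrK.
have := qbin_fact (q ^+ r) lejm; rewrite !qfact_qpoch => e.
have e2 : eqm (q ^+ n) (qbin (q ^+ r) m j * (Eq r * Eq r)) (Eq r).
  apply: eqm_trans (eqmMl _ (eqmM (eqm_Eq_le r0 lenj) (eqm_Eq_le r0 lenmj))) _.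
  by rewrite e; apply: eqm_sym; apply: eqm_Eq_le => //; lia.
have := eqmMl (Eq r)^-1 e2; rewrite mulVr ?Eq_unit //.
rewrite (_ : (Eq r)^-1 * _ = Eq r * qbin (q ^+ r) m j) //.
by rewrite [LHS]mulrC -!mulrA divrr ?Eq_unit // mulr1 mulrC.
Qed.

(* Exponent of q in [jweight (q ^+ al) (q ^+ be) k]. *)
Definition wt (al be : nat) (k : int) : nat := (al * tri k + be * tri (k - 1))%N.

Lemma wtE al be k : (wt al be k)%:Z * 2 = al%:Z * (k * (k + 1)) + be%:Z * (k * (k - 1)).
Proof.
by rewrite /wt PoszD !PoszM mulrDl -!mulrA !triE subrK [(k - 1) * k]mulrC.
Qed.

(** Only boundedly many k have small weight, so a range cut at N loses nothing modulo small powers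
    of q. *)
Lemma wt_ge al be k : (0 < al + be)%N -> (absz k <= (wt al be k).+1)%N.
Proof.
rewrite addn_gt0 /wt => /orP[] pos.
  by apply: leq_trans (tri_le k) _; rewrite ltnS; apply: leq_trans (leq_addr _ _); exact: leq_pmull.
by apply: leq_trans (tri_le1 k) _; rewrite ltnS; apply: leq_trans (leq_addl _ _); exact: leq_pmull.
Qed.

Definition zrange (N : nat) : seq int := [seq j%:Z - N%:Z | j <- iota 0 (N + N).+1].

Lemma mem_zrange N k : (k \in zrange N) = (absz k <= N)%N.
Proof.
apply/mapP/idP => [[j]|lekN]; first by rewrite mem_iota => /andP[_ ltj] ->; lia.
by exists (absz (k + N%:Z)); rewrite ?mem_iota; lia.
Qed.

Lemma zrange_uniq N : uniq (zrange N).
Proof. by rewrite map_inj_uniq ?iota_uniq // => i j; lia. Qed.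

(** For |k| at most n, the bound 2n <= N leaves room on both sides of index k + N, and the binomial
    times E is 1 modulo q^n. For |k| > n the weight is at least n, so both terms vanish. *)
Lemma jacobi_mod al be n N : (0 < al + be)%N -> (n.*2 <= N)%N ->
  eqm (q ^+ n)%:P
    ((Eq (al + be))%:P * jprod N N (q ^+ al)%:P (q ^+ be)%:P 'X)
    (\sum_(k <- zrange N) (q ^+ wt al be k)%:P * 'X^(absz (k + N%:Z))).
Proof.
move=> pos lenN; rewrite finite_jacobi big_map.
rewrite -[iota 0 _]/(index_iota 0 (N + N).+1) big_mkord mulr_sumr.
apply: eqm_sum => j _ _.
rewrite (_ : absz _ = j); last by lia.
rewrite mulrA; apply: eqmMr; set k := j%:Z - N%:Z.
rewrite -rmorphM /= -exprD -(qbin_morph (@polyC ps)) /jweight.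
rewrite -!rmorphXn -!rmorphM /= -!exprM -exprD -/(wt al be k); apply: eqm_morph.
rewrite mulrA -[X in eqm _ _ X]mul1r.
have [lekn|ltnk] := leqP (absz k) n.
  by apply: eqmMr; apply: qbin_mod => //; have := ltn_ord j; rewrite /k in lekn; lia.
have lenw : (n <= wt al be k)%N by have := wt_ge k pos; lia.
apply: eqm_trans (eqmMl _ (eqm_pexp q lenw)) _; rewrite mulr0.
by apply: eqm_sym; rewrite mul1r; exact: eqm_pexp.
Qed.

Lemma jacobi_mod1 al be n N : (0 < al + be)%N -> (n.*2 <= N)%N ->
  eqm (q ^+ n) (Eq (al + be) * jprod N N (q ^+ al) (q ^+ be) 1)
    (\sum_(k <- zrange N) q ^+ wt al be k).
Proof.
move=> pos lenN; have := eqm_morph (horner_eval (1 : ps)) (jacobi_mod pos lenN).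
rewrite rmorphM /= jprod_morph rmorph_sum /= /horner_eval !hornerC hornerX.
congr eqm; apply: eq_bigr => k _.
by rewrite hornerM hornerC hornerXn expr1n mulr1.
Qed.

(** A weight-preserving bijection between [P] and [Q], which may be infinite. The lists need not
    correspond to each other: they contain every point of weight below n, and the other points
    vanish modulo q^n. *)
Lemma sum_bij_mod (T U : eqType) (s : seq T) (t : seq U) (P : pred T) (Q : pred U)
    (W : T -> nat) (V : U -> nat) (f : T -> U) (g : U -> T) n :
  uniq s -> uniq t ->
  (forall x, P x -> (W x < n)%N -> x \in s) -> (forall y, Q y -> (V y < n)%N -> y \in t) ->
  (forall x, P x -> [/\ Q (f x), V (f x) = W x & g (f x) = x]) ->
  (forall y, Q y -> P (g y) /\ f (g y) = y) ->
  eqm (q ^+ n) (\sum_(x <- s | P x) q ^+ W x) (\sum_(y <- t | Q y) q ^+ V y).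
Proof.
move=> us ut sW tV fP gP.
have small (I : eqType) (r : seq I) (A : pred I) (X : I -> nat) :
    eqm (q ^+ n) (\sum_(i <- r | A i) q ^+ X i)
      (\sum_(i <- [seq i <- r | A i && (X i < n)%N]) q ^+ X i).
  rewrite big_filter (bigID (fun i => X i < n)%N) /= -[X in eqm _ _ X]addr0.
  apply: eqmD; first exact: eqm_refl.
  apply: eqm_trans (eqm_sum (G := fun=> 0) _) _; last by rewrite big1 //; exact: eqm_refl.
  by move=> i _ /andP[_]; rewrite -leqNgt; exact: eqm_pexp.
apply: eqm_trans (small _ _ _ _) _; apply: eqm_trans (eqm_sym (small _ _ _ _)).
set s' := [seq x <- s | _]; set t' := [seq y <- t | _].
have fs' x : x \in s' -> P x by rewrite mem_filter => /andP[/andP[]].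
have <- : \sum_(y <- [seq f x | x <- s']) q ^+ V y = \sum_(x <- s') q ^+ W x.
  by rewrite big_map; apply: eq_big_seq => x /fs' /fP[_ ->].
rewrite (perm_big t') /=; first exact: eqm_refl.
apply: uniq_perm; rewrite ?filter_uniq //.
  rewrite map_inj_in_uniq ?filter_uniq // => x y /fs' /fP[_ _ {2}<-] /fs' /fP[_ _ {2}<-].
  by move->.
move=> y; apply/mapP/idP => [[x] xs ->|].
  have [Qfx Vfx _] := fP _ (fs' _ xs).
  move: xs; rewrite !mem_filter => /andP[/andP[Px Wx] _].
  by rewrite Qfx Vfx Wx tV // Vfx.
rewrite mem_filter => /andP[/andP[Qy Vy] yt].
have [Pg fg] := gP _ Qy; have [_ Wg _] := fP _ Pg.
exists (g y) => //; rewrite mem_filter Pg -Wg fg Vy /=.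
by apply: sW => //; rewrite -Wg fg.
Qed.

(** * The lattice bijections *)

(** The exponent of q at the triple (-a-b, a, b) in the product of the theta series with parameters
    (0,3), (1,2), (2,1); the zero sum selects z^0. *)
Definition qwt (p : int * int) : nat :=
  (wt 0 3 (- p.1 - p.2) + (wt 1 2 p.1 + wt 2 1 p.2))%N.

Lemma qwtE a b :
  (qwt (a, b))%:Z = 3 * (a * a + a * b + b * b) + a + 2 * b.
Proof.
have e0 := wtE 0 3 (- a - b); have e1 := wtE 1 2 a; have e2 := wtE 2 1 b.
by rewrite /qwt /=; lia.
Qed.

(** The exponent in the product of the theta series with parameters (4,2) and (6,2), which equals
    a(q^2). *)
Definition dwt (p : int * int) : nat := (wt 4 2 p.1 + wt 6 2 p.2)%N.

Lemma dwtE x l : (dwt (x, l))%:Z = 3 * (x * x) + x + 4 * (l * l) + 2 * l.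
Proof.
have e1 := wtE 4 2 x; have e2 := wtE 6 2 l.
by rewrite /dwt /=; lia.
Qed.

Definition box N : seq (int * int) := [seq (a, b) | a <- zrange N, b <- zrange N].

Lemma mem_box N a b : ((a, b) \in box N) = (absz a <= N)%N && (absz b <= N)%N.
Proof.
rewrite -!mem_zrange; apply/allpairsP/andP => [[[x y] /= [? ?] [-> ->]] //|[? ?]].
by exists (a, b).
Qed.

Definition odd_pt (p : int * int) : bool := ((p.1 %% 2)%Z == 0) && ((p.2 %% 2)%Z == 1).

(** Inverse of the affine map (x, y) -> (-2x, -1-2y), which sends a weight w to 4w + 1. *)
Definition odd_fold (p : int * int) : int * int :=
  (- (p.1 %/ 2)%Z, - ((p.2 + 1) %/ 2)%Z).

Definition odd_unfold (p : int * int) : int * int := (- 2 * p.1, - 1 - 2 * p.2).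

Lemma odd_foldP p : odd_pt p ->
  (4 * qwt (odd_fold p)).+1 = qwt p /\ odd_unfold (odd_fold p) = p.
Proof.
case: p => a b /andP[/= /eqP ea /eqP eb].
have ea2 : a = - 2 * - (a %/ 2)%Z by lia.
have eb2 : b = - 1 - 2 * - ((b + 1) %/ 2)%Z by lia.
rewrite /odd_unfold /odd_fold /= -ea2 -eb2; split=> //.
move: (- (a %/ 2)%Z) (- ((b + 1) %/ 2)%Z) ea2 eb2 => x y -> ->.
by have := qwtE x y; have := qwtE (- 2 * x) (- 1 - 2 * y); lia.
Qed.

Lemma odd_unfoldP p : odd_pt (odd_unfold p) /\ odd_fold (odd_unfold p) = p.
Proof.
case: p => x y; rewrite /odd_pt /odd_fold /odd_unfold /=; split; first by lia.
by congr (_, _); lia.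
Qed.

(* When b is even the weight is 3u^2 + u + k^2 + k with u = a + b/2 and k = 3b/2, and k may
   be replaced by -1-k to make it even, k = 2l.  When a and b are odd, a rotation by 60
   degrees of the hexagonal lattice gives the same form with k = 1 mod 3, which the first
   case misses. *)
Definition even_fold (p : int * int) : int * int :=
  let: (a, b) := p in
  if (b %% 2)%Z == 0 then
    let y := (b %/ 2)%Z in
    (a + y, if (y %% 2)%Z == 0 then 3 * (y %/ 2)%Z else - 2 - 3 * (y %/ 2)%Z)
  else
    let u := ((- a - 2 * b - 1) %/ 2)%Z in
    (u, - 1 - 3 * (if (u %% 2)%Z == 0 then ((a - 1) %/ 4)%Z else ((- a - 1) %/ 4)%Z)).

(** The residue of l modulo 3 recovers the case of [even_fold]: 0 for b = 0 mod 4, 1 for b = 2 mod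
    4, 2 for b odd. *)
Definition even_unfold (p : int * int) : int * int :=
  let: (x, l) := p in
  if (l %% 3)%Z == 2 then
    let a := if (x %% 2)%Z == 0 then 1 + 4 * ((- 1 - l) %/ 3)%Z
             else - 1 - 4 * ((- 1 - l) %/ 3)%Z in
    (a, ((- a - 1 - 2 * x) %/ 2)%Z)
  else
    let y := if (l %% 3)%Z == 0 then 2 * (l %/ 3)%Z else 2 * ((- 2 - l) %/ 3)%Z + 1 in
    (x - y, 2 * y).

Lemma even_foldP p : ~~ odd_pt p ->
  dwt (even_fold p) = qwt p /\ even_unfold (even_fold p) = p.
Proof.
case: p => a b; rewrite /odd_pt /= => np; split.
  rewrite /even_fold; case: eqP => eb.
    (* Each quotient is replaced by a variable, after which both weights are the same polynomial. *)
    have : b = 2 * (b %/ 2)%Z by lia.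
    move: (b %/ 2)%Z => y {np eb} -> /=; case: eqP => ey.
      have : y = 2 * (y %/ 2)%Z by lia.
      move: (y %/ 2)%Z => z {ey} ->.
      by have := dwtE (a + 2 * z) (3 * z); have := qwtE a (2 * (2 * z)); lia.
    have : y = 2 * (y %/ 2)%Z + 1 by lia.
    move: (y %/ 2)%Z => z {ey} ->.
    have := dwtE (a + (2 * z + 1)) (- 2 - 3 * z).
    by have := qwtE a (2 * (2 * z + 1)); lia.
  have : - a - 2 * b - 1 = 2 * ((- a - 2 * b - 1) %/ 2)%Z by lia.
  move: ((- a - 2 * b - 1) %/ 2)%Z => u eu /=; case: eqP => eu2.
    have ea : a = 4 * ((a - 1) %/ 4)%Z + 1 by lia.
    move: ((a - 1) %/ 4)%Z ea => m ea.
    have {}eu : b = - 2 * m - 1 - u by lia.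
    subst a b; have := dwtE u (- 1 - 3 * m).
    by have := qwtE (4 * m + 1) (- 2 * m - 1 - u); lia.
  have ea : a = - 4 * ((- a - 1) %/ 4)%Z - 1 by lia.
  move: ((- a - 1) %/ 4)%Z ea => m ea.
  have {}eu : b = 2 * m - u by lia.
  subst a b; have := dwtE u (- 1 - 3 * m).
  by have := qwtE (- 4 * m - 1) (2 * m - u); lia.
rewrite /even_fold; case: eqP => eb /=.
  have [ey|ey] := eqVneq ((b %/ 2)%Z %% 2)%Z 0; rewrite /even_unfold.
    by rewrite ifF ?ifT; [congr (_, _)| |]; lia.
  by rewrite ifF ?ifF; [congr (_, _)| |]; lia.
have [eu|eu] := eqVneq (((- a - 2 * b - 1) %/ 2)%Z %% 2)%Z 0; rewrite /even_unfold.
  by rewrite ifT ?eu //=; [congr (_, _)|]; lia.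
by rewrite ifT ?(negPf eu) //=; [congr (_, _)|]; lia.
Qed.

Lemma even_unfoldP p : ~~ odd_pt (even_unfold p) /\ even_fold (even_unfold p) = p.
Proof.
case: p => x l; rewrite /even_unfold; case: eqP => el.
  case: eqP => ex; rewrite /odd_pt /even_fold /=; (split; first by lia).
    rewrite ifF; last by lia.
    by rewrite ifT; [congr (_, _); lia|lia].
  rewrite ifF; last by lia.
  by rewrite ifF; [congr (_, _); lia|lia].
case: eqP => el0; rewrite /odd_pt /even_fold /=; (split; first by lia).
  rewrite ifT; last by lia.
  by rewrite ifT; [congr (_, _); lia|lia].
rewrite ifT; last by lia.
by rewrite ifF; [congr (_, _); lia|lia].
Qed.

(** * The lattice sum of E(q^3)^3 / E(q) *)

Lemma box_uniq N : uniq (box N).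
Proof.
by apply: allpairs_uniq; rewrite ?zrange_uniq // => -[? ?] [? ?] _ _ /= [-> ->].
Qed.

Lemma qwt_box n N p : (qwt p < n)%N -> (n <= N)%N -> p \in box N.
Proof.
case: p => a b; rewrite mem_box /qwt /= => ltn leN.
by have := @wt_ge 1 2 a isT; have := @wt_ge 2 1 b isT; lia.
Qed.

Lemma dwt_box n N p : (dwt p < n)%N -> (n <= N)%N -> p \in box N.
Proof.
case: p => a b; rewrite mem_box /dwt /= => ltn leN.
by have := @wt_ge 4 2 a isT; have := @wt_ge 6 2 b isT; lia.
Qed.

(** A truncation of E(q^3)^3 / E(q), as [Eq3_cube_qtheta] shows. *)
Definition qtheta N : ps := \sum_(p <- box N) q ^+ qwt p.

Lemma dilateXn k m : dilate k.+1 (q ^+ m) = q ^+ (k.+1 * m).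
Proof. by rewrite rmorphXn /= dilateX exprM. Qed.

Lemma big_box (N : nat) (F G : int -> ps) :
  (\sum_(a <- zrange N) F a) * (\sum_(b <- zrange N) G b) =
  \sum_(p <- box N) F p.1 * G p.2.
Proof. by rewrite big_distrlr /= /box big_allpairs. Qed.

(** The points outside [odd_pt] are matched by [even_fold] with the product of theta series, the
    others by [odd_fold] with q times the series at q^4. *)
Lemma qtheta_dissection n N : (n <= N)%N ->
  eqm (q ^+ n) (qtheta N)
    ((\sum_(x <- zrange N) q ^+ wt 4 2 x) * (\sum_(l <- zrange N) q ^+ wt 6 2 l)
     + q * dilate 2 (dilate 2 (qtheta N))).
Proof.
move=> lenN; rewrite big_box /qtheta.
rewrite [X in eqm _ X _](bigID odd_pt) /= [X in eqm _ X _]addrC; apply: eqmD.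
  under [X in eqm _ _ X]eq_bigr => p _ do rewrite -exprD -/(dwt p).
  apply: (sum_bij_mod (f := even_fold) (g := even_unfold)); rewrite ?box_uniq //.
  - by move=> p _ /qwt_box; apply.
  - by move=> p _ /dwt_box; apply.
  - by move=> p /even_foldP[].
  - by move=> p _; exact: even_unfoldP.
rewrite !rmorph_sum mulr_sumr.
under [X in eqm _ _ X]eq_bigr => p _.
  rewrite /= !dilateXn mulnA -exprS -[(2 * 2)%N]/4%N; over.
apply: (sum_bij_mod (f := odd_fold) (g := odd_unfold)); rewrite ?box_uniq //.
- by move=> p _ /qwt_box; apply.
- by move=> p _ ltn; apply: (@qwt_box n) => //; lia.
- by move=> p /odd_foldP[].
- by move=> p _; exact: odd_unfoldP.
Qed.

Lemma jprod_powers (R : comNzRingType) (x z : R) al be M N :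
  jprod M N (x ^+ al) (x ^+ be) z =
  (\prod_(i < M) (1 + z * x ^+ ((al + be) * i + al))) *
  (\prod_(i < N) (z + x ^+ ((al + be) * i + be))).
Proof.
rewrite /jprod; congr (_ * _); apply: eq_bigr => i _; rewrite -!exprM -exprD.
  by congr (1 + z * x ^+ _); lia.
by congr (z + x ^+ _); lia.
Qed.

Lemma prod_mul2 (R : comNzRingType) (F : nat -> R) N :
  \prod_(i < 2 * N) F i = \prod_(i < N) (F (2 * i)%N * F (2 * i).+1).
Proof.
elim: N => [|N IHN]; first by rewrite !big_ord0.
by rewrite mulnS !big_ord_recr /= IHN mulrA.
Qed.

Lemma prod_mul3 (R : comNzRingType) (F : nat -> R) N :
  \prod_(i < 3 * N) F i = \prod_(i < N) (F (3 * i)%N * F (3 * i).+1 * F (3 * i).+2).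
Proof.
elim: N => [|N IHN]; first by rewrite !big_ord0.
by rewrite mulnS !big_ord_recr /= IHN !mulrA.
Qed.

(** The factors in base x are sorted by their exponent modulo 3, with residues 0, 1, 2 in the first
    family and 1, 2, 3 in the second. *)
Lemma jprod_split3 (R : comNzRingType) (x z : R) N :
  jprod N N (x ^+ 0) (x ^+ 3) z *
    (jprod N N (x ^+ 1) (x ^+ 2) z * jprod N N (x ^+ 2) (x ^+ 1) z) =
  jprod (3 * N) (3 * N) (x ^+ 0) (x ^+ 1) z.
Proof.
pose A r := \prod_(i < N) (1 + z * x ^+ (3 * i + r)).
pose B r := \prod_(i < N) (z + x ^+ (3 * i + r)).
rewrite !jprod_powers -[LHS]/(A 0%N * B 3%N * (A 1%N * B 2%N * (A 2%N * B 1%N))).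
rewrite (prod_mul3 (fun i => 1 + z * x ^+ ((0 + 1) * i + 0))).
rewrite (prod_mul3 (fun i => z + x ^+ ((0 + 1) * i + 1))).
transitivity ((A 0%N * A 1%N * A 2%N) * (B 1%N * B 2%N * B 3%N)); first by ring.
rewrite -!big_split /=; apply: eq_bigr => i _; congr (_ * _ * _ * (_ * _ * _)).
all: by first [congr (1 + z * x ^+ _) | congr (z + x ^+ _)]; lia.
Qed.

Lemma eqm_coef (R : comNzRingType) (u : R) (p r : {poly R}) j :
  eqm u%:P p r -> eqm u p`_j r`_j.
Proof. by case=> h ->; exists h`_j; rewrite coefD coefCM. Qed.

(* Both sides are read off the coefficient of z^(3N) in [jprod_split3]. *)
Lemma Eq3_cube_qtheta n N : (n.*2 <= N)%N ->
  eqm (q ^+ n) (Eq 3 ^+ 3) (Eq 1 * qtheta N).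
Proof.
move=> lenN; pose P al be := jprod N N (q ^+ al)%:P (q ^+ be)%:P ('X : {poly ps}).
pose L := P 0%N 3%N * (P 1%N 2%N * P 2%N 1%N).
have eL : L = jprod (3 * N) (3 * N) (q ^+ 0)%:P (q ^+ 1)%:P 'X.
  by rewrite /L /P -jprod_split3 !rmorphXn.
(* In base q the power z^(3N) comes from k = 0 alone, whose weight is 0. *)
have L1 : eqm (q ^+ n) (Eq 1 * L`_(3 * N)) 1.
  have le3N : (n.*2 <= 3 * N)%N by lia.
  have := eqm_coef (3 * N) (@jacobi_mod 0 1 n (3 * N) isT le3N).
  rewrite -eL coefCM => e; apply: eqm_trans e _.
  rewrite coef_sum (bigD1_seq 0) ?mem_zrange ?zrange_uniq //= coefCM coefXn.
  rewrite eqxx mulr1 /wt -[tri 0]/0%N -[tri _]/0%N expr0 big1_seq.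
    by rewrite addr0; exact: eqm_refl.
  move=> k /andP[k0]; rewrite mem_zrange coefCM coefXn => lek.
  by case: eqP; rewrite ?mulr0 //; lia.
have L3 : eqm (q ^+ n) (Eq 3 ^+ 3 * L`_(3 * N)) (qtheta N).
  have h0 : eqm _ ((Eq 3)%:P * P 0%N 3%N) _ := @jacobi_mod 0 3 n N isT lenN.
  have h1 : eqm _ ((Eq 3)%:P * P 1%N 2%N) _ := @jacobi_mod 1 2 n N isT lenN.
  have h2 : eqm _ ((Eq 3)%:P * P 2%N 1%N) _ := @jacobi_mod 2 1 n N isT lenN.
  have := eqmM h0 (eqmM h1 h2); rewrite (_ : _ * _ * (_ * _ * _) = (Eq 3 ^+ 3)%:P * L); last first.
    rewrite /L rmorphXn /=; move: (P 0%N _) (P 1%N _) (P 2%N _) => x y z.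
    by ring.
  move=> /(eqm_coef (3 * N)); rewrite coefCM => e; apply: eqm_trans e _.
  pose T := [seq (k, p) | k <- zrange N, p <- box N].
  pose w (t : int * (int * int)) := (wt 0 3 t.1 + (wt 1 2 t.2.1 + wt 2 1 t.2.2))%N.
  pose deg (t : int * (int * int)) :=
    (absz (t.1 + N%:Z)%R + (absz (t.2.1 + N%:Z)%R + absz (t.2.2 + N%:Z)%R))%N.
  rewrite (_ : _ * (_ * _) = \sum_(t <- T) (q ^+ w t)%:P * 'X^(deg t)); last first.
    rewrite big_distrl /T big_allpairs /=; apply: eq_bigr => k _.
    rewrite big_distrlr /= mulr_sumr /box big_allpairs; apply: eq_bigr => a _.
    rewrite mulr_sumr; apply: eq_bigr => b _.
    by rewrite /w /deg !exprD !rmorphM /=; ring.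
  (* Each index is shifted by N in the degree, so z^(3N) collects the triples of sum zero. *)
  rewrite coef_sum (_ : \sum_(k <- _) _ = \sum_(t <- T | t.1 + t.2.1 + t.2.2 == 0) q ^+ w t).
    apply: (sum_bij_mod (f := snd) (g := fun p => (- p.1 - p.2, p))); rewrite ?box_uniq //.
    - by apply: allpairs_uniq; rewrite ?zrange_uniq ?box_uniq // => -[? ?] [? ?] _ _ /= [-> ->].
    - move=> [k [a b]] _; rewrite /w /= => ltn; apply: allpairs_f.
        by rewrite mem_zrange; have := @wt_ge 0 3 k isT; lia.
      by rewrite mem_box; have := @wt_ge 1 2 a isT; have := @wt_ge 2 1 b isT; lia.
    - by move=> p _ ltn; apply: (@qwt_box n) => //; lia.
    - move=> [k [a b]] /= /eqP e0; rewrite /qwt /w /=.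
      have ek : - a - b = k by lia.
      by rewrite ek.
    - by move=> [a b] _; split=> //=; lia.
  rewrite [RHS]big_mkcond; apply: eq_big_seq => -[k [a b]] /allpairsP[[k' [a' b']] /=].
  rewrite mem_zrange mem_box => -[lek /andP[lea leb] [-> -> ->]].
  rewrite coefCM coefXn /deg /= (_ : (_ == _ :> nat) = (k' + a' + b' == 0)); last by lia.
  by case: eqP; rewrite ?mulr1 ?mulr0.
apply: eqm_sym; apply: eqm_trans (eqmMl _ (eqm_sym L3)) _.
by rewrite mulrCA -[X in eqm _ _ X]mulr1; exact: eqmMl.
Qed.

(** * Relations between the E(q^k) *)

(** In the limit [pplus k] is E(q^(2k)) / E(q^k), and [podd k] is E(q^(2k))^2 / (E(q^k)
    E(q^(4k))). *)
Definition pplus (k N : nat) : ps := \prod_(i < N) (1 + q ^+ (k * i.+1)).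
Definition podd (k N : nat) : ps := \prod_(i < N) (1 + q ^+ (k * (2 * i).+1)).

Lemma qpochMpplus k N : qpoch k N * pplus k N = qpoch (2 * k) N.
Proof.
rewrite -big_split; apply: eq_bigr => i _ /=.
by rewrite -mulnA mul2n -addnn exprD; ring.
Qed.

Lemma EqMpplus n k N : (0 < k)%N -> (n <= N)%N ->
  eqm (q ^+ n) (Eq k * pplus k N) (Eq (2 * k)).
Proof.
move=> k0 lenN; apply: eqm_trans (eqmMr _ (eqm_Eq_le k0 lenN)) _.
by rewrite qpochMpplus; apply: eqm_sym; apply: eqm_Eq_le; rewrite ?muln_gt0.
Qed.

Lemma poddMpplus k N : podd k N * pplus (2 * k) N = pplus k (2 * N).
Proof.
rewrite /pplus (prod_mul2 (fun i => 1 + q ^+ (k * i.+1))) -big_split /=.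
by apply: eq_bigr => i _; congr (_ * (1 + q ^+ _)); lia.
Qed.

Lemma podd_Eq n k N : (0 < k)%N -> (n <= N)%N ->
  eqm (q ^+ n) (podd k N * (Eq k * Eq (4 * k))) (Eq (2 * k) ^+ 2).
Proof.
move=> k0 lenN; have k20 : (0 < 2 * k)%N by rewrite muln_gt0.
have e4 : eqm (q ^+ n) (Eq (2 * k) * pplus (2 * k) N) (Eq (4 * k)).
  by rewrite -[4%N]/(2 * 2)%N -mulnA; exact: EqMpplus.
have e2 : eqm (q ^+ n) (Eq k * pplus k (2 * N)) (Eq (2 * k)).
  by apply: EqMpplus => //; lia.
apply: eqm_trans (eqmMl _ (eqmMl _ (eqm_sym e4))) _.
rewrite [X in eqm _ X _](_ : _ = Eq (2 * k) * (Eq k * pplus k (2 * N))).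
  by rewrite expr2; exact: eqmMl.
by rewrite -poddMpplus; ring.
Qed.

(** For odd k the factors 1 - q^(k m) with m even are fixed and form E(q^(2k)); those with m odd
    become 1 + q^(k m) and form [podd k]. *)
Lemma flip_Eq k : odd k -> flip (Eq k) * (Eq k * Eq (4 * k)) = Eq (2 * k) ^+ 3.
Proof.
move=> ok; have k0 : (0 < k)%N by case: k ok.
apply: eqm_ps_ext => n.
have e : eqm (q ^+ n) (flip (Eq k)) (podd k n * Eq (2 * k)).
  have : eqm (q ^+ n) (Eq k) (qpoch k (2 * n)) by apply: eqm_Eq_le => //; lia.
  move=> /(eqm_morph flip); rewrite /= flipXn => e.
  (* The flipped modulus (-1)^n q^n is a multiple of q^n. *)
  apply: eqm_trans (eqm_dvd (v := q ^+ n) (w := (-1) ^+ n) _) _.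
    by rewrite mulrC; exact: e.
  rewrite /= /qpoch (prod_mul2 (fun i => 1 - q ^+ (k * i.+1))) big_split /= rmorphM.
  rewrite !rmorph_prod /= [X in eqm _ (X * _) _](_ : _ = podd k n); last first.
    apply: eq_bigr => i _; rewrite rmorphB rmorph1 /= flipXn -signr_odd oddM ok /=.
    by rewrite oddM /= expr1 mulN1r opprK.
  apply: eqmMl; rewrite [X in eqm _ X _](_ : _ = qpoch (2 * k) n).
    by apply: eqm_sym; apply: eqm_Eq_le => //; rewrite muln_gt0.
  apply: eq_bigr => i _; rewrite rmorphB rmorph1 /= flipXn -signr_odd oddM ok /=.
  by rewrite oddM /= expr0 mul1r; congr (1 - q ^+ _); lia.
apply: eqm_trans (eqmMr _ e) _.
rewrite [X in eqm _ X _](_ : _ = Eq (2 * k) * (podd k n * (Eq k * Eq (4 * k)))); last by ring.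
by rewrite exprS; apply: eqmMl; exact: podd_Eq.
Qed.

(** The triple product has the factors 1 + q^(2m) with m prime to 3; [pplus 6] supplies the missing
    multiples of 3. *)
Lemma sum_wt42_Eq n N : (n.*2 <= N)%N ->
  eqm (q ^+ n) ((\sum_(k <- zrange N) q ^+ wt 4 2 k) * (Eq 12 * Eq 2)) (Eq 4 * Eq 6 ^+ 2).
Proof.
move=> leN; have e : eqm _ (Eq 6 * _) _ := @jacobi_mod1 4 2 n N isT leN.
apply: eqm_trans (eqmMr _ (eqm_sym e)) _.
set J := jprod _ _ _ _ _.
have JE : J * pplus 6 N = pplus 2 (3 * N).
  rewrite /J jprod_powers /pplus (prod_mul3 (fun i => 1 + q ^+ (2 * i.+1))).
  rewrite -!big_split /=; apply: eq_bigr => i _.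
  rewrite mul1r [_ * (1 + q ^+ ((4 + 2) * i + 2))]mulrC.
  by congr ((1 + q ^+ _) * (1 + q ^+ _) * (1 + q ^+ _)); lia.
have e12 : eqm (q ^+ n) (Eq 6 * pplus 6 N) (Eq 12) by apply: EqMpplus => //; lia.
have e4 : eqm (q ^+ n) (Eq 2 * pplus 2 (3 * N)) (Eq 4) by apply: EqMpplus => //; lia.
apply: eqm_trans (eqmMl _ (eqmMr _ (eqm_sym e12))) _.
rewrite [X in eqm _ X _](_ : _ = (Eq 2 * pplus 2 (3 * N)) * Eq 6 ^+ 2); first exact: eqmMr.
by rewrite -JE; ring.
Qed.

(** The exponents 8i + 2 and 8i + 6 together are those congruent to 2 modulo 4, which gives
    [podd 2]. *)
Lemma sum_wt62_Eq n N : (n.*2 <= N)%N ->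
  eqm (q ^+ n) ((\sum_(k <- zrange N) q ^+ wt 6 2 k) * Eq 2) (Eq 4 ^+ 2).
Proof.
move=> leN; have e : eqm _ (Eq 8 * _) _ := @jacobi_mod1 6 2 n N isT leN.
apply: eqm_trans (eqmMr _ (eqm_sym e)) _.
rewrite [X in eqm _ X _](_ : _ = podd 2 (2 * N) * (Eq 2 * Eq 8)).
  by apply: (@podd_Eq n 2) => //; lia.
rewrite (_ : jprod _ _ _ _ _ = podd 2 (2 * N)); first by ring.
rewrite jprod_powers /podd (prod_mul2 (fun i => 1 + q ^+ (2 * (2 * i).+1))).
rewrite -!big_split /=; apply: eq_bigr => i _.
by rewrite mul1r mulrC; congr ((1 + q ^+ _) * (1 + q ^+ _)); lia.
Qed.

(** [qtheta_dissection] with its theta series written as products and its last term as q E(q^12)^3 /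
    E(q^4), denominators cleared. *)
Lemma Eq_dissection :
  Eq 3 ^+ 3 * (Eq 2 ^+ 2 * Eq 12 * Eq 4) =
  Eq 1 * (Eq 4 ^+ 4 * Eq 6 ^+ 2 + q * (Eq 12 ^+ 4 * Eq 2 ^+ 2)).
Proof.
apply: eqm_ps_ext => n; set N := n.*2.
have e3 := @Eq3_cube_qtheta n N (leqnn _).
apply: eqm_trans (eqmMr _ e3) _.
have leN : (n <= N)%N by rewrite /N; lia.
apply: eqm_trans (eqmMr _ (eqmMl _ (qtheta_dissection leN))) _.
have e12 : eqm (q ^+ n) (Eq 4 * dilate 2 (dilate 2 (qtheta N))) (Eq 12 ^+ 3).
  have := eqm_morph (dilate 2) (eqm_morph (dilate 2) e3).
  rewrite /= !dilateXn !rmorphXn !rmorphM /= !dilate_Eq // => e.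
  by apply: eqm_sym; apply: eqm_le e; lia.
have e42 := @sum_wt42_Eq n N (leqnn _); have e62 := @sum_wt62_Eq n N (leqnn _).
move: (\sum_(k <- _) _) (\sum_(k <- _) _) (dilate 2 _) e12 e42 e62 => G F S e12 e42 e62.
rewrite [X in eqm _ X _](_ : _ = Eq 1 * ((F * (Eq 12 * Eq 2)) * (G * Eq 2) * Eq 4
   + q * (Eq 2 ^+ 2 * Eq 12 * (Eq 4 * S)))); last by ring.
apply: eqmMl.
rewrite (_ : Eq 4 ^+ 4 * _ = (Eq 4 * Eq 6 ^+ 2) * (Eq 4 ^+ 2) * Eq 4); last by ring.
apply: eqmD; first by apply: eqmMr; exact: eqmM.
apply: eqmMl; rewrite (_ : Eq 12 ^+ 4 * _ = (Eq 2 ^+ 2 * Eq 12) * Eq 12 ^+ 3); last by ring.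
exact: eqmMl.
Qed.

(* The product of [Eq_dissection] and its image under q -> -q, read at q^(1/2). *)
Lemma Eq_level6 :
  Eq 2 ^+ 8 * Eq 3 ^+ 4 * Eq 6 =
  Eq 1 * Eq 2 ^+ 3 * Eq 3 ^+ 9 + q * (Eq 1 ^+ 4 * Eq 6 ^+ 9).
Proof.
have d1 : dilate 2 (Eq 1) = Eq 2 := @dilate_Eq 1 1 isT.
have d2 : dilate 2 (Eq 2) = Eq 4 := @dilate_Eq 1 2 isT.
have d3 : dilate 2 (Eq 3) = Eq 6 := @dilate_Eq 1 3 isT.
have d6 : dilate 2 (Eq 6) = Eq 12 := @dilate_Eq 1 6 isT.
have f1 : flip (Eq 1) * (Eq 1 * Eq 4) = Eq 2 ^+ 3 := @flip_Eq 1 isT.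
have f3 : flip (Eq 3) * (Eq 3 * Eq 12) = Eq 6 ^+ 3 := @flip_Eq 3 isT.
have e := Eq_dissection.
have fe : flip (Eq 3) ^+ 3 * (Eq 2 ^+ 2 * Eq 12 * Eq 4) =
    flip (Eq 1) * (Eq 4 ^+ 4 * Eq 6 ^+ 2 - q * (Eq 12 ^+ 4 * Eq 2 ^+ 2)).
  have := congr1 flip e; rewrite -d1 -d2 -d3 -d6 !(rmorphM, rmorphD, rmorphXn) /=.
  by rewrite !flip_dilate flipX mulNr.
(* Multiplied by this factor and dilated, the goal becomes [e2] below with the negative term moved
   across. *)
apply: (mulfI (x := Eq 1 ^+ 3 * Eq 6 ^+ 2)).
  by rewrite mulf_neq0 // expf_neq0 // Eq_neq0.
apply: dilate2_inj; rewrite !(rmorphM, rmorphD, rmorphXn) /= d1 d2 d3 d6 dilateX.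
have : (Eq 3 ^+ 3 * (Eq 2 ^+ 2 * Eq 12 * Eq 4)) * (flip (Eq 3) ^+ 3 * (Eq 2 ^+ 2 * Eq 12 * Eq 4))
   * (Eq 12 ^+ 3 * Eq 4) =
    (flip (Eq 3) * (Eq 3 * Eq 12)) ^+ 3 * (Eq 2 ^+ 2 * Eq 12 * Eq 4) ^+ 2 * Eq 4.
  by ring.
rewrite e fe f3 => e'.
have : (flip (Eq 1) * (Eq 1 * Eq 4)) * Eq 12 ^+ 3 *
    ((Eq 4 ^+ 4 * Eq 6 ^+ 2) ^+ 2 - q ^+ 2 * (Eq 12 ^+ 4 * Eq 2 ^+ 2) ^+ 2) =
    (Eq 6 ^+ 3) ^+ 3 * (Eq 2 ^+ 2 * Eq 12 * Eq 4) ^+ 2 * Eq 4.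
  by rewrite -e'; ring.
rewrite f1 => e2.
rewrite [RHS](_ : _ = (Eq 6 ^+ 3) ^+ 3 * (Eq 2 ^+ 2 * Eq 12 * Eq 4) ^+ 2 * Eq 4
   + q ^+ 2 * (Eq 2 ^+ 7 * Eq 12 ^+ 11)); last by ring.
by rewrite -e2; ring.
Qed.

(** * The recurrence for zeta *)

(* Eta-quotient identities are checked by [field]; an abstract embedding keeps
   {fraction ps} from being unfolded. *)
Lemma ps_field_embedding :
  exists (F : fieldType) (f : {rmorphism ps -> F}), injective f.
Proof.
exists {fraction ps}, (@FracField.tofrac ps) => f g /eqP.
by rewrite tofrac_eq => /eqP.
Qed.

Lemma psXn0 (f : ps) k : (f ^+ k) 0%N = f 0%N ^+ k.
Proof. by elim: k => // k IHk; rewrite !exprS psM0 IHk. Qed.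

Lemma psV0 (f : ps) : f 0%N = 1 -> f^-1 0%N = 1.
Proof. by move=> f0; rewrite -psinv_inv. Qed.

Lemma gammaE : gamma = Eq 1 ^+ 5 * (Eq 2 ^+ 5 * (Eq 6 ^+ 5 * (Eq 3 ^+ 15)^-1)).
Proof. by rewrite /gamma !psexpE psinv_inv // psXn0 Eq_0 expr1n. Qed.

Lemma gamma0 : gamma 0%N = 1.
Proof. by rewrite gammaE !psM0 psV0 ?psXn0 ?Eq_0 ?expr1n // !psXn0 !Eq_0. Qed.

Lemma xiE : xi = Eq 2 ^+ 5 * (Eq 6 * (Eq 1 * Eq 3 ^+ 5)^-1).
Proof.
rewrite /xi !psexpE -[psmul (Eq 1) _]/(Eq 1 * Eq 3 ^+ 5) psinv_inv //.
by rewrite psM0 psXn0 !Eq_0 expr1n.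
Qed.

Lemma kappaE : kappa = dilate 2 gamma ^+ 2 * gamma^-1.
Proof. by rewrite /kappa psexpE psinv_inv // gamma0. Qed.

(** * Eta quotients and the dissection of kappa *)

Definition eta_a : ps := Eq 2 ^+ 3 * Eq 3 ^+ 2 * (Eq 1 ^+ 2 * Eq 6)^-1.
Definition eta_b : ps := Eq 6 ^+ 3 * (Eq 2)^-1.
(** Since 1/gamma is (E(q^3)^3 / E(q))^5 / (E(q^2) E(q^6))^5, the series g(q^2) collects the part of
    [kappa] outside the fifth power. *)
Definition eta_g : ps := gamma ^+ 2 * ((Eq 1 * Eq 3) ^+ 5)^-1.

Section EtaQuotients.
Variables (F : fieldType) (x e1 e2 e3 e4 e6 e12 : F).
Hypotheses (n1 : e1 != 0) (n2 : e2 != 0) (n3 : e3 != 0) (n4 : e4 != 0) (n6 : e6 != 0)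
  (n12 : e12 != 0).

Lemma cube_quotient :
  e3 ^+ 3 * (e2 ^+ 2 * e12 * e4) = e1 * (e4 ^+ 4 * e6 ^+ 2 + x * (e12 ^+ 4 * e2 ^+ 2)) ->
  e3 ^+ 3 * e1^-1 =
  e4 ^+ 3 * e6 ^+ 2 * (e2 ^+ 2 * e12)^-1 + x * (e12 ^+ 3 * e4^-1).
Proof.
move=> e; have n : e2 ^+ 2 * e12 * e4 != 0 by rewrite !mulf_neq0 ?expf_neq0.
by apply: (mulIf n); rewrite mulrAC e; field; rewrite n1 n2 n4 n12.
Qed.

Lemma kappa_quotient :
  (e1 ^+ 5 * (e2 ^+ 5 * (e6 ^+ 5 * (e3 ^+ 15)^-1)))^-1 =
  ((e2 * e6) ^+ 5)^-1 * (e3 ^+ 3 * e1^-1) ^+ 5.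
Proof. by field; rewrite n1 n2 n3 n6. Qed.

Lemma xi_quotient :
  (e1 ^+ 5 * (e2 ^+ 5 * (e6 ^+ 5 * (e3 ^+ 15)^-1))) ^+ 2 * ((e1 * e3) ^+ 5)^-1 *
    (e2 ^+ 3 * e3 ^+ 2 * (e1 ^+ 2 * e6)^-1) ^+ 5 =
  (e2 ^+ 5 * (e6 * (e1 * e3 ^+ 5)^-1)) ^+ 5.
Proof. by field; rewrite n1 n3 n6. Qed.

Lemma xi1_quotient :
  e2 ^+ 8 * e3 ^+ 4 * e6 = e1 * e2 ^+ 3 * e3 ^+ 9 + x * (e1 ^+ 4 * e6 ^+ 9) ->
  x * (e6 ^+ 3 * e2^-1) ^+ 2 * (e2 ^+ 5 * (e6 * (e1 * e3 ^+ 5)^-1)) =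
  (e2 ^+ 3 * e3 ^+ 2 * (e1 ^+ 2 * e6)^-1) ^+ 2 * (e2 ^+ 5 * (e6 * (e1 * e3 ^+ 5)^-1) - 1).
Proof.
(* Solving the relation for x leaves an identity of rational functions. *)
move=> e; have -> : x = (e2 ^+ 8 * e3 ^+ 4 * e6 - e1 * e2 ^+ 3 * e3 ^+ 9) / (e1 ^+ 4 * e6 ^+ 9).
  by rewrite e; field; rewrite n1 n6.
by field; rewrite n1 n2 n3 n6.
Qed.

End EtaQuotients.

(** Packed as a tuple so that one repeated rewrite uses all four equations. *)
Lemma dilate2_Eq :
  ((dilate 2 (Eq 1) = Eq 2) * (dilate 2 (Eq 2) = Eq 4) *
   (dilate 2 (Eq 3) = Eq 6) * (dilate 2 (Eq 6) = Eq 12))%type.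
Proof.
by do !split; [exact: (@dilate_Eq 1 1) | exact: (@dilate_Eq 1 2) |
  exact: (@dilate_Eq 1 3) | exact: (@dilate_Eq 1 6)].
Qed.

Lemma dilate2_eta_ab :
  dilate 2 eta_a + q * dilate 2 eta_b =
  Eq 4 ^+ 3 * Eq 6 ^+ 2 * (Eq 2 ^+ 2 * Eq 12)^-1 + q * (Eq 12 ^+ 3 * (Eq 4)^-1).
Proof.
rewrite /eta_a /eta_b !(rmorphXn, rmorphM) /= !rmorphV ?(unitrM, unitrX) ?Eq_unit //.
by rewrite !(rmorphXn, rmorphM) /= !dilate2_Eq.
Qed.

Lemma cube_dissection : Eq 3 ^+ 3 * (Eq 1)^-1 = dilate 2 eta_a + q * dilate 2 eta_b.
Proof.
rewrite dilate2_eta_ab; have [F [f f_inj]] := ps_field_embedding; apply: (f_inj).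
have nz k : f (Eq k) != 0 by rewrite raddf_eq0 ?Eq_neq0.
have := congr1 f Eq_dissection.
rewrite !(rmorphXn, rmorphM, rmorphD) /= !rmorphV ?(unitrM, unitrX) ?Eq_unit //.
by rewrite !(rmorphXn, rmorphM) /=; exact: cube_quotient.
Qed.

Lemma kappa_dissection :
  kappa = dilate 2 eta_g * (dilate 2 eta_a + q * dilate 2 eta_b) ^+ 5.
Proof.
have -> : dilate 2 eta_g = dilate 2 gamma ^+ 2 * ((Eq 2 * Eq 6) ^+ 5)^-1.
  rewrite /eta_g !(rmorphXn, rmorphM) /= !rmorphV ?(unitrM, unitrX) ?Eq_unit //.
  by rewrite !(rmorphXn, rmorphM) /= !dilate2_Eq.
rewrite -cube_dissection kappaE -mulrA; congr (_ * _).
have [F [f f_inj]] := ps_field_embedding; apply: (f_inj).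
have nz k : f (Eq k) != 0 by rewrite raddf_eq0 ?Eq_neq0.
rewrite rmorphV ?ps_unitP ?gamma0 // gammaE !(rmorphXn, rmorphM) /=.
rewrite !rmorphV ?(unitrM, unitrX) ?Eq_unit // !(rmorphXn, rmorphM) /=.
exact: kappa_quotient.
Qed.

Lemma eta_g_xi : eta_g * eta_a ^+ 5 = xi ^+ 5.
Proof.
have [F [f f_inj]] := ps_field_embedding; apply: (f_inj).
have nz k : f (Eq k) != 0 by rewrite raddf_eq0 ?Eq_neq0.
rewrite /eta_g /eta_a xiE gammaE !(rmorphXn, rmorphM) /=.
rewrite !rmorphV ?(unitrM, unitrX) ?Eq_unit // !(rmorphXn, rmorphM) /=.
exact: xi_quotient.
Qed.

Lemma eta_ab_xi : q * eta_b ^+ 2 * xi = eta_a ^+ 2 * (xi - 1).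
Proof.
have [F [f f_inj]] := ps_field_embedding; apply: (f_inj).
have nz k : f (Eq k) != 0 by rewrite raddf_eq0 ?Eq_neq0.
have := congr1 f Eq_level6.
rewrite /eta_b /eta_a xiE !(rmorphXn, rmorphM, rmorphB, rmorphD, rmorph1) /=.
rewrite !rmorphV ?(unitrM, unitrX) ?Eq_unit // !(rmorphXn, rmorphM) /=.
exact: xi1_quotient.
Qed.

Definition zeta1 : ps := xi ^+ 3 * (16%:R * xi ^+ 2 - 20%:R * xi + 5%:R).

Lemma xi_unit : xi \is a GRing.unit.
Proof. by rewrite xiE !(unitrM, unitrV, unitrX) // !Eq_unit. Qed.

(* The second equation is kappa(q) kappa(-q) = xi(q^2)^5. *)
Lemma kappa_parts : exists2 be : ps,
  kappa = dilate 2 zeta1 + q * dilate 2 be & zeta1 ^+ 2 - q * be ^+ 2 = xi ^+ 5.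
Proof.
pose a := eta_a; pose b := eta_b; pose g := eta_g.
have ga : g * a ^+ 5 = xi ^+ 5 := eta_g_xi.
have qb : q * b ^+ 2 * xi = a ^+ 2 * (xi - 1) := eta_ab_xi.
have xiI k : injective ( *%R (xi ^+ k)) by apply: mulrI; rewrite unitrX ?xi_unit.
(* The binomial expansion of g(q^2) (a(q^2) + q b(q^2))^5, split by the parity of the power of q and
   read at q^(1/2). *)
pose al := g * (a ^+ 5 + 10%:R * q * a ^+ 3 * b ^+ 2 + 5%:R * q ^+ 2 * a * b ^+ 4).
pose be := g * (5%:R * a ^+ 4 * b + 10%:R * q * a ^+ 2 * b ^+ 3 + q ^+ 2 * b ^+ 5).
have -> : zeta1 = al.
  (* The factor xi^2 lets q b^2 occur only in the product q b^2 xi, replaced by a^2 (xi - 1). *)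
  apply: (xiI 2%N); rewrite /zeta1 /al.
  rewrite [RHS](_ : _ = g * (a ^+ 5 * xi ^+ 2 + 10%:R * a ^+ 3 * xi * (q * b ^+ 2 * xi)
    + 5%:R * a * (q * b ^+ 2 * xi) ^+ 2)); last by ring.
  rewrite qb [RHS](_ : _ = (g * a ^+ 5) * (xi ^+ 2 + 10%:R * xi * (xi - 1)
    + 5%:R * (xi - 1) ^+ 2)); last by ring.
  by rewrite ga; ring.
exists be.
  rewrite kappa_dissection /al /be !(rmorphM, rmorphD, rmorphXn, rmorph_nat) /= dilateX.
  by rewrite -/g -/a -/b; ring.
(* The difference is g^2 (a^2 - q b^2)^5, and (a^2 - q b^2) xi = a^2. *)
apply: (xiI 5%N).
rewrite (_ : _ * _ = g ^+ 2 * (a ^+ 2 * xi - q * b ^+ 2 * xi) ^+ 5); last first.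
  by rewrite /al /be; ring.
rewrite qb (_ : _ - _ = a ^+ 2); last by ring.
by rewrite -ga; ring.
Qed.

Lemma zetaE i : zeta i 0 = Uop (kappa ^+ i).
Proof. by rewrite /zeta psexpE -[psmul _ _]/(kappa ^+ i * 1) mulr1. Qed.

Lemma zeta_0 : zeta 0 0 = 1.
Proof. by rewrite zetaE expr0 Uop1. Qed.

Lemma zeta_1 : zeta 1 0 = zeta1.
Proof.
have [be ke _] := kappa_parts.
by rewrite zetaE expr1 ke UopD Uop_dilate UopXdilate addr0.
Qed.

(** [kappa] is a root of T^2 - 2 zeta1(q^2) T + xi(q^2)^5; multiply by kappa^i and apply U, linear
    over series in q^2. *)
Lemma zeta_rec i : zeta i.+2 0 = 2%:R * zeta1 * zeta i.+1 0 - xi ^+ 5 * zeta i 0.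
Proof.
have [be ke xe] := kappa_parts.
have k2 : kappa ^+ 2 = dilate 2 (2%:R * zeta1) * kappa + dilate 2 (- xi ^+ 5).
  rewrite -xe ke rmorphN rmorphB /= [dilate 2 (q * _)]rmorphM [dilate 2 (_ * zeta1)]rmorphM.
  rewrite !rmorphXn rmorph_nat /= dilateX.
  by move: (dilate 2 _) (dilate 2 _) => z b; ring.
rewrite !zetaE -addn2 exprD k2 mulrDr mulrCA -exprSr UopD Uop_dilateM.
by rewrite [kappa ^+ i * _]mulrC Uop_dilateM mulNr.
Qed.

(** * zeta as polynomials in xi *)

(** If xi were 1, [eta_ab_xi] would force q b^2 = 0. *)
Lemma xi_neq1 : xi != 1.
Proof.
apply/eqP => xi1; have := eta_ab_xi; rewrite xi1 subrr mulr0 mulr1.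
move/eqP; rewrite mulf_eq0 (negPf psX_neq0) /= sqrf_eq0.
by rewrite /eta_b mulf_eq0 expf_eq0 invr_eq0 !(negPf (Eq_neq0 _)).
Qed.

Lemma xi0 : xi 0%N = 1.
Proof.
rewrite xiE !psM0 psV0; first by rewrite psXn0 !Eq_0.
by rewrite psM0 psXn0 !Eq_0.
Qed.

Definition pev (x : ps) (p : {poly int}) : ps := (map_poly intr p).[x].

Lemma psMz (f : ps) (k : int) n : (f *~ k) n = f n * k.
Proof.
have psMn (m : nat) : (f *+ m) n = f n * m%:Z.
  elim: m => [|m IHm]; first by rewrite mulr0n mulr0.
  by rewrite mulrS psD IHm intS mulrDr mulr1.
by case: k => m; rewrite /intmul ?psN psMn // NegzE mulrN.
Qed.

Lemma psevalE p x : pseval p x = pev x p.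
Proof.
apply/funext => n; rewrite /pev (horner_coef_wide x (size_poly _ _)) /pseval.
rewrite (big_morph (fun f : ps => f n) (id1 := 0) (op1 := +%R)) //.
apply: eq_bigr => m _; rewrite coef_map_id0 // psexpE.
by rewrite mulrzl psMz mulrC.
Qed.

(** The coefficient of q^0 shows that p has no constant term; dividing by y lowers the degree. *)
Lemma pev_inj_shift (y : ps) (p : {poly int}) :
  y != 0 -> y 0%N = 0 -> pev y p = 0 -> p = 0.
Proof.
move=> yn0 y0; elim/poly_ind: p => // p c IHp.
rewrite /pev rmorphD rmorphM /= map_polyX map_polyC /= !hornerE => e.
have c0 : c = 0.
  have := congr1 (fun f : ps => f 0%N) e.
  by rewrite psD psM0 y0 mulr0 add0r ps0 psMz ps1 mul1r.
rewrite c0 IHp ?mul0r ?addr0 //; move/eqP: e.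
by rewrite c0 addr0 mulf_eq0 (negPf yn0) orbF => /eqP.
Qed.

(** Uniqueness of the polynomial expressing [zeta]. As xi has constant term 1, the argument runs in
    the variable xi - 1. *)
Lemma pev_xi_inj : injective (pev xi).
Proof.
move=> p r e; apply/eqP; rewrite -subr_eq0; apply/eqP.
have e0 : pev xi (p - r) = 0 by rewrite /pev rmorphB /= hornerD hornerN [X in X - _]e subrr.
move: (p - r) e0 => {e}p e.
have : pev (xi - 1) (p \Po ('X + 1%:P)) = 0.
  rewrite -e /pev map_comp_poly rmorphD /= map_polyX map_polyC /= horner_comp !hornerE.
  by rewrite mulr1z subrK.
move/pev_inj_shift; rewrite subr_eq0 xi_neq1 psD psN xi0 ps1 subrr => /(_ isT erefl) p0.
by rewrite -[p](comp_polyXaddC_K _ 1) p0 comp_poly0.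
Qed.

(** * Splitting off the power of X and rescaling to 4X *)

Definition cpoly : {poly int} := 16%:R * 'X ^+ 2 - 20%:R * 'X + 5%:R.

(** What remains of z_{2I} and z_{2I+1} after removing X^(5I) and X^(5I+3). The extra X in the first
    rule comes from 3 + 3 = 5 + 1. *)
Fixpoint evpoly (I : nat) : {poly int} * {poly int} :=
  if I is I'.+1 then
    let: (A, B) := evpoly I' in
    let A' := 2%:R * 'X * cpoly * B - A in (A', 2%:R * cpoly * A' - B)
  else (1, cpoly).

Section Evaluation.
Variable x : ps.

Lemma pevM p r : pev x (p * r) = pev x p * pev x r.
Proof. by rewrite /pev rmorphM hornerM. Qed.

Lemma pevD p r : pev x (p + r) = pev x p + pev x r.
Proof. by rewrite /pev rmorphD hornerD. Qed.

Lemma pevB p r : pev x (p - r) = pev x p - pev x r.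
Proof. by rewrite /pev rmorphB hornerD hornerN. Qed.

Lemma pevXn m : pev x 'X^m = x ^+ m.
Proof. by rewrite /pev map_polyXn hornerXn. Qed.

Lemma pevX : pev x 'X = x.
Proof. by rewrite /pev map_polyX hornerX. Qed.

Lemma pev_nat m : pev x m%:R = m%:R.
Proof. by rewrite /pev rmorph_nat -(rmorph_nat (@polyC ps)) hornerC. Qed.

End Evaluation.

Definition pevE := (pev_nat, pevXn, pevX, pevB, pevM, pevD).

Lemma pev_cpoly : xi ^+ 3 * pev xi cpoly = zeta1.
Proof. by rewrite /cpoly !pevE. Qed.

Lemma zeta_evpoly I :
  zeta I.*2 0 = pev xi ('X ^+ (5 * I) * (evpoly I).1) /\
  zeta I.*2.+1 0 = pev xi ('X ^+ (5 * I + 3) * (evpoly I).2).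
Proof.
elim: I => [|I [IHA IHB]].
  by rewrite zeta_0 zeta_1 -pev_cpoly /= mulr1 !pevE !muln0 !expr0.
have eA : zeta I.+1.*2 0 = pev xi ('X ^+ (5 * I.+1) * (evpoly I.+1).1).
  rewrite doubleS zeta_rec IHA IHB /= -pev_cpoly; case: (evpoly I) => A B /=.
  rewrite !pevE mulnS !exprD.
  by ring.
split=> //; rewrite doubleS zeta_rec -doubleS eA IHB /= -pev_cpoly.
case: (evpoly I) => A B /=.
set A' := 2%:R * 'X * cpoly * B - A.
rewrite !pevM pevB !pevE mulnS !exprD.
by ring.
Qed.

(* [cpoly] in the variable 4X; likewise [ypoly I] is (2A, B) in that variable. *)
Definition yq : {poly int} := 'X ^+ 2 - 5%:R * 'X + 5%:R.

Fixpoint ypoly (I : nat) : {poly int} * {poly int} :=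
  if I is I'.+1 then
    let: (e, b) := ypoly I' in
    let e' := 'X * yq * b - e in (e', yq * e' - b)
  else (2%:R, yq).

Definition scale4 (p : {poly int}) : {poly int} := p \Po (4%:R * 'X).

Lemma coef_scale4 p n : (scale4 p)`_n = 4%:R ^+ n * p`_n.
Proof.
rewrite /scale4 comp_polyE coef_sum.
rewrite (eq_bigr (fun i : 'I_(size p) => (n == i)%:R * (4%:R ^+ n * p`_n))).
  have [ltn|len] := ltnP n (size p).
    rewrite (bigD1 (Ordinal ltn)) //= eqxx mul1r big1 ?addr0 // => i.
    by rewrite -val_eqE /= eq_sym => /negPf->; rewrite mul0r.
  by rewrite nth_default // mulr0 big1 // => i _; rewrite mulr0.
move=> i _; rewrite -(rmorph_nat (@polyC int)) exprMn -rmorphXn /= coefZ coefCM coefXn.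
by case: eqP => [->|_]; rewrite ?mulr0 ?mul0r // mulr1 mul1r mulrC.
Qed.

(** Doubling the first component turns 2X into 4X, so both rules become integral in 4X. *)
Lemma evpoly_scale4 I :
  2%:R * (evpoly I).1 = scale4 (ypoly I).1 /\ (evpoly I).2 = scale4 (ypoly I).2.
Proof.
have sM (f g : {poly int}) : scale4 (f * g) = scale4 f * scale4 g by exact: rmorphM.
have sB (f g : {poly int}) : scale4 (f - g) = scale4 f - scale4 g by exact: rmorphB.
have sX : scale4 'X = 4%:R * 'X by exact: comp_polyX.
have sq : scale4 yq = cpoly.
  rewrite /scale4 /yq !(rmorphM, rmorphD, rmorphN, rmorphXn, rmorph_nat) /= comp_polyX /cpoly.
  by ring.
elim: I => [|I]; first by split; rewrite ?sq //= mulr1 /scale4 rmorph_nat.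
rewrite /=; case: (evpoly I) => A B; case: (ypoly I) => e b /= [eA eB].
split; first by rewrite sB !sM sX sq -eA -eB; ring.
by rewrite !sB !sM sq sB !sM sX sq -eA -eB; ring.
Qed.

(** The factor X makes the constant term of e change sign at each step. That of b stays odd, and
    e'_1 = 5 b_0 - e_1 then changes parity. *)
Lemma ypoly_low I :
  [/\ (ypoly I).1`_0 = 2%:R * (-1) ^+ I, exists m : int, (ypoly I).2`_0 = 2%:R * m + 1
    & exists m : int, (ypoly I).1`_1 = 2%:R * m + (odd I)%:R].
Proof.
have q0 : yq`_0 = 5%:R.
  by rewrite /yq -!(rmorph_nat (@polyC int)) coefD coefB coefCM coefXn coefX coefC.
elim: I => [|I].
  split; first by rewrite /= mulr1 -(rmorph_nat (@polyC int)) coefC.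
    by exists 2%:R; rewrite /= q0.
  by exists 0; rewrite /= mulr0 addr0 -(rmorph_nat (@polyC int)) coefC.
rewrite /=; case: (ypoly I) => e b /= [e0 [m bm] [k ek]].
have e0' : ('X * yq * b - e)`_0 = 2%:R * (-1) ^+ I.+1.
  by rewrite coefB -mulrA coefXM /= sub0r e0 exprS; ring.
split=> //.
  exists (5%:R * (-1) ^+ I.+1 - m - 1).
  by rewrite coefB coef0M q0 e0' bm; ring.
exists (5%:R * m - k + 2%:R).
rewrite coefB -mulrA coefXM /= coef0M q0 bm ek.
by case: (odd I) => /=; ring.
Qed.

(** * Valuations *)

Lemma nu_geP (z : int) k : reflect (exists m : int, z = m * (2 ^ k)%N%:Z) (nu_ge z k).
Proof. exact: dvdzP. Qed.

Lemma nu_eq0_odd (m : int) : nu_eq (2%:R * m + 1) 0.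
Proof.
apply/andP; split; first by apply/nu_geP; exists (2%:R * m + 1); rewrite mulr1.
by apply/nu_geP => -[k]; lia.
Qed.

(** The coefficients are 2^(2M-1) e_M and 4^M b_M, and 2M - 1 >= M + 1 once M >= 2. At M = 1 the
    first is 2 e_1, where e_1 has the parity of I. *)
Lemma evpoly_valuation I :
  [/\ nu_eq (evpoly I).1`_0 0,
      (if odd I then nu_eq (evpoly I).1`_1 1 else nu_ge (evpoly I).1`_1 2)
    & forall M, (2 <= M)%N -> nu_ge (evpoly I).1`_M M.+1] /\
  [/\ nu_eq (evpoly I).2`_0 0, nu_ge (evpoly I).2`_1 2
    & forall M, (2 <= M)%N -> nu_ge (evpoly I).2`_M M.+1].
Proof.
have [eA eB] := evpoly_scale4 I; have [e0 [m bm] [k ek]] := ypoly_low I.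
have pow4 (M : nat) : 4%:R ^+ M = (2 ^ (2 * M))%N%:Z.
  by rewrite expnM -natz natrX.
have cA M : 2%:R * (evpoly I).1`_M = 4%:R ^+ M * (ypoly I).1`_M.
  by rewrite -coef_scale4 -eA -(rmorph_nat (@polyC int)) coefCM.
have cB M : (evpoly I).2`_M = 4%:R ^+ M * (ypoly I).2`_M by rewrite -coef_scale4 -eB.
have leM M : (2 <= M)%N -> (2 * M = (M - 2) + M.+1 + 1)%N by lia.
split; split.
- have -> : (evpoly I).1`_0 = (-1) ^+ I by have := cA 0%N; rewrite e0 expr0 mul1r; lia.
  rewrite -signr_odd; case: (odd I).
    by rewrite (_ : _ ^+ _ = 2%:R * (- 1) + 1) ?nu_eq0_odd.
  by rewrite (_ : _ ^+ _ = 2%:R * 0 + 1) ?nu_eq0_odd.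
- have -> : (evpoly I).1`_1 = 2%:R * (2%:R * k + (odd I)%:R).
    by have := cA 1%N; rewrite ek expr1; lia.
  case: (odd I); last by apply/nu_geP; exists k; lia.
  apply/andP; split; first by apply/nu_geP; exists (2%:R * k + 1); lia.
  by apply/nu_geP => -[j]; lia.
- move=> M /leM eM; apply/nu_geP; exists ((2 ^ (M - 2))%N%:Z * (ypoly I).1`_M).
  apply: (@mulfI _ (2%:R : int)) => //.
  by rewrite cA pow4 eM !expnD !PoszM expn1; ring.
- by rewrite cB expr0 mul1r bm; exact: nu_eq0_odd.
- by rewrite cB expr1; apply/nu_geP; exists (ypoly I).2`_1; lia.
- move=> M /leM eM; apply/nu_geP; exists (2%:R * (2 ^ (M - 2))%N%:Z * (ypoly I).2`_M).
  by rewrite cB pow4 eM !expnD !PoszM expn1; ring.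
Qed.

Unset Implicit Arguments.

Theorem theorem4p2 :
  forall (i : nat) (Z : {poly int}),
    (forall n : nat, zeta i 0 n = pseval Z xi n) ->
    [/\ nu_eq Z`_(d i 0) 0,
        (if (i %% 4 == 2)%N then nu_eq Z`_(d i 0 + 1) 1
         else nu_ge Z`_(d i 0 + 1) 2)
      & forall M : nat, (2 <= M)%N -> nu_ge Z`_(d i 0 + M) M.+1].
Proof.
move=> i Z /funext; rewrite psevalE => zetaZ.
have coefXnD k (p : {poly int}) M : ('X ^+ k * p)`_(k + M) = p`_M.
  by rewrite coefXnM ltnNge leq_addr addKn.
have [zA zB] := zeta_evpoly i./2; have [vA vB] := evpoly_valuation i./2.
case oi: (odd i).
  have iE : i = i./2.*2.+1 by rewrite -[LHS]odd_double_half oi.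
  (* Evaluation at [xi] is injective, so [Z] must be this polynomial. *)
  have -> : Z = 'X ^+ (5 * i./2 + 3) * (evpoly i./2).2.
    by apply: pev_xi_inj; rewrite -zB -iE.
  have -> : d i 0 = (5 * i./2 + 3)%N by rewrite /d oi addn0.
  have [v0 v1 vM] := vB.
  split=> [||M leM]; rewrite ?coefXnD //; last exact: vM.
    by rewrite -[X in _`_X]addn0 coefXnD.
  by rewrite ifF //; lia.
have iE : i = i./2.*2 by rewrite -[LHS]odd_double_half oi.
have -> : Z = 'X ^+ (5 * i./2) * (evpoly i./2).1.
  by apply: pev_xi_inj; rewrite -zA -iE.
have -> : d i 0 = (5 * i./2)%N by rewrite /d oi addn0.
have [v0 v1 vM] := vA.
split=> [||M leM]; rewrite ?coefXnD //; last exact: vM.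
  by rewrite -[X in _`_X]addn0 coefXnD.
(* With i = 2I, the condition i = 2 mod 4 says that I is odd. *)
by rewrite (_ : (i %% 4 == 2)%N = odd i./2) //; lia.
Qed.
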